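(* For the spectral Galerkin approximation $\{u^M\}_{M\in\mathbb N}$ of the stochastic linear Schr\''odinger equation described in the context, $\{u^M\}_{M\in\mathbb N}$ weakly asymptotically preserves the LDP of $\{B_T\}_{T>0}$; that is, for each $x\in Q^{\frac12}(H^0)$ and each $\varepsilon>0$ there exist $x_0\in H^0$ and $M\in\mathbb N$ such that $$\|x-x_0\|_{H^0}<\varepsilon,\qquad \left|I(x)-I^M(x_0)\right|<\varepsilon,$$ where $I$ is the large deviations rate function of $\{B_T\}_{T>0}$, $B_T=u(T)/T$, and $I^M$ is the large deviations rate function on $H^0$ of $\{B^M_T\}_{T>0}$, $B^M_T=u^M(T)/T$.
   Context: Notation: $\bm{i}$ is the imaginary unit; $H^0=L^2(0,\pi;\mathbb C)$, $U^0=L^2(0,\pi;\mathbb R)$, $U^1=H^1(0,\pi;\mathbb R)$, $H^1_0(0,\pi)=\{f\in H^1(0,\pi;\mathbb C): f(0)=f(\pi)=0\}$; $\langle f,g\rangle_{\mathbb C}=\int_0^\pi f\bar g\,dx$. Setting: $\alpha>0$; $\Delta$ is the Dirichlet Laplacian on $(0,\pi)$; $e_k(x)=\sqrt{2/\pi}\,\sin(kx)$. $Q$ is a nonnegative symmetric operator on $U^0$ with $Qe_k=\eta_ke_k$ for a non-increasing sequence $\{\eta_k\}_{k\in\mathbb N}$ of nonnegative reals, and $Q^{1/2}$ is a Hilbert--Schmidt operator from $U^0$ to $U^1$. $Q$ is extended to $H^0$ by $Qf=Q(\Re f)+\bm{i}Q(\Im f)$. $W(t)=\sum_{k\ge1}\sqrt{\eta_k}\,\beta_k(t)e_k$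 is a $U^0$-valued $Q$-Wiener process with independent standard real Brownian motions $\beta_k$. The equation is $du=\bm{i}\Delta u\,dt+\bm{i}\alpha\,dW(t)$, $u(0)=u_0\in H^1_0(0,\pi)$ deterministic, with mild solution $u(t)=e^{\bm{i}t\Delta}u_0+\bm{i}\alpha\int_0^te^{\bm{i}(t-s)\Delta}\,dW(s)$. Galerkin approximation: $H_M=\mathrm{span}_{\mathbb C}\{e_1,\dots,e_M\}$, $P_Mx=\sum_{k=1}^M\langle x,e_k\rangle_{\mathbb C}e_k$, $\Delta_M=\Delta P_M$, and $u^M$ solves $du^M(t)=\bm{i}\Delta_Mu^M(t)\,dt+\bm{i}\alpha P_M\,dW(t)$, $u^M(0)=P_Mu_0$. LDP: $\{Z_T\}_{T>0}$ in $H^0$ satisfies an LDP with (lower semicontinuous) rate function $I:H^0\to[0,\infty]$ if $\liminf_{T\to\infty}\frac1T\ln \mathbf P(Z_T\in G)\ge-\inf_G I$ for every open $G$ and $\limsup_{T\to\infty}\frac1T\ln \mathbf P(Z_T\in C)\le-\inf_C I$ for every closed $C$. The rate functions: $\{B_T\}_{T>0}$ satisfies an LDP on $H^0$ with $I(x)=\frac1{\alpha^2}\|Q^{-1/2}x\|_{H^0}^2$ for $x\in Q^{1/2}(H^0)$ and $I(x)=+\infty$ otherwise; for each $M$, $\{B^M_T\}_{T>0}$ satisfies an LDP on $H^0$ with $I^M(x)=\frac1{\alpha^2}\|Q_M^{-1/2}x\|_{H^0}^2$ for $x\in Q_M^{1/2}(H^0)$ and $I^M(x)=+\infty$ otherwise,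 where $Q_M=QP_M$. Here $Q^{-1/2}x$ (resp. $Q_M^{-1/2}x$) is the element $z$ of minimal norm in $H^0$ (resp. $H_M$) with $Q^{1/2}z=x$ (resp. $Q_M^{1/2}z=x$). *)

(* Defs.v *)
From HB Require Import structures.
From mathcomp Require Import all_boot all_order all_algebra.
From mathcomp Require Import complex.
From mathcomp Require Import ring lra.
From mathcomp Require Import all_classical all_reals all_analysis measurable_realfun.

Set Implicit Arguments.
Unset Strict Implicit.
Unset Printing Implicit Defensive.

Import Order.TTheory GRing.Theory Num.Theory.
Import numFieldNormedType.Exports.

Local Open Scope classical_set_scope.
Local Open Scope complex_scope.
Local Open Scope ring_scope.

Definition mu0pi (R : realType) : {measure set (measurableTypeR R) -> \bar R} :=
  mrestr (@lebesgue_measure R) (measurable_itv `]0, pi[).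

(* An element of L^2 is given by a square-integrable representative; equality in
   L^2 is [=u], resp. [=h] below, i.e. almost everywhere equality. *)
Definition U0 (R : realType) : Type := LfunType (mu0pi R) (lee1n 2).

HB.instance Definition _ (R : realType) :=
  GRing.Lmodule.copy (U0 R) (LfunType (mu0pi R) (lee1n 2)).

Definition eqU (R : realType) (f g : U0 R) : Prop :=
  (f : R -> R) = (g : R -> R) %[ae mu0pi R].

Notation "f =u g" := (eqU f g) (at level 70, no associativity).

(* f = Re f + i Im f is stored as the pair (Re f, Im f). *)
Definition H0 (R : realType) : Type := (U0 R * U0 R)%type.

HB.instance Definition _ (R : realType) :=
  GRing.Zmodule.copy (H0 R) (U0 R * U0 R)%type.

Definition eqH (R : realType) (x y : H0 R) : Prop := x.1 =u y.1 /\ x.2 =u y.2.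

Notation "x =h y" := (eqH x y) (at level 70, no associativity).

Section ComplexStructure.
Variable R : realType.
Implicit Types (f g h : U0 R) (x y z : H0 R) (a b : R[i]).

Definition cscale a x : H0 R :=
  (complex.Re a *: x.1 - complex.Im a *: x.2,
   complex.Re a *: x.2 + complex.Im a *: x.1).

Let valZ (c : R) f t : (c *: f) t = c * f t. Proof. by []. Qed.
Let valD f g t : (f + g) t = f t + g t. Proof. by []. Qed.
Let valN f t : (- f) t = - f t. Proof. by []. Qed.
Let valE := (valD, valN, valZ).

Let cscaleA a b x : cscale a (cscale b x) = cscale (a * b) x.
Proof.
case: a b x => [a1 a2] [b1 b2] [f g]; rewrite /cscale /=.
by congr pair; apply/LfuneqP => t; rewrite !valE /=; ring.
Qed.

Let cscale1 : left_id 1 cscale.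
Proof.
case=> f g; rewrite /cscale /=.
by congr pair; apply/LfuneqP => t; rewrite !valE /=; ring.
Qed.

Let cscaleDr : right_distributive cscale +%R.
Proof.
case=> [a1 a2] [f g] [h k]; rewrite /cscale /=.
by congr pair; apply/LfuneqP => t; rewrite !valE /=; ring.
Qed.

Let cscaleDl x : {morph cscale^~ x : a b / a + b}.
Proof.
case: x => [f g] [a1 a2] [b1 b2]; rewrite /cscale /=.
by congr pair; apply/LfuneqP => t; rewrite !valE /=; ring.
Qed.

HB.instance Definition _ := GRing.Zmodule_isLmodule.Build R[i] (H0 R)
  cscaleA cscale1 cscaleDr cscaleDl.

Lemma scale_realE (c : R) x : c%:C *: x = (c *: x.1, c *: x.2).
Proof. by congr pair; apply/LfuneqP => t; rewrite !valE /=; ring. Qed.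

Definition ipU f g : R := \int[mu0pi R]_t (f t * g t).
Definition normU f : R := Num.sqrt (ipU f f).

(* \int x \bar y, expanded on real and imaginary parts. *)
Definition ipH x y : R[i] :=
  (ipU x.1 y.1 + ipU x.2 y.2) +i* (ipU x.2 y.1 - ipU x.1 y.2).
Definition normH x : R := Num.sqrt (complex.Re (ipH x x)).

Let ipU_intg f g : (mu0pi R).-integrable setT (EFin \o (f \* g)).
Proof. by apply/Lfun1_integrable; apply: Lfun2_mul_Lfun1; exact: LfunP. Qed.

Lemma ipUC f g : ipU f g = ipU g f.
Proof. by apply: eq_Rintegral => t _; rewrite mulrC. Qed.

Lemma ipUDl f g h : ipU (f + g) h = ipU f h + ipU g h.
Proof.
rewrite /ipU -RintegralD//; [|exact: ipU_intg..].
by apply: eq_Rintegral => t _; rewrite mulrDl.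
Qed.

Lemma ipUZl (c : R) f g : ipU (c *: f) g = c * ipU f g.
Proof.
rewrite /ipU -RintegralZl//; [|exact: ipU_intg].
by apply: eq_Rintegral => t _; rewrite mulrA.
Qed.

Lemma ipU_ge0 f : 0 <= ipU f f.
Proof. by apply: Rintegral_ge0 => t _; rewrite -expr2 sqr_ge0. Qed.

Definition reH x y : R := complex.Re (ipH x y).

Let BC x y : reH x y = reH y x.
Proof. by rewrite /reH/= (ipUC x.1) (ipUC x.2). Qed.

Let BDl x y z : reH (x + y) z = reH x z + reH y z.
Proof. by rewrite /reH/= !ipUDl; ring. Qed.

Let BZl (c : R) x y : reH (c%:C *: x) y = c * reH x y.
Proof. by rewrite /reH scale_realE/= !ipUZl mulrDr. Qed.

Let B_ge0 x : 0 <= reH x x.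
Proof. by rewrite /reH/= addr_ge0// ipU_ge0. Qed.

Let CS x y : reH x y <= normH x * normH y.
Proof.
suff h : reH x y ^+ 2 <= reH x x * reH y y.
  rewrite leNgt; apply/negP => lt_xy; move: h; rewrite leNgt => /negP; apply.
  have nn : 0 <= normH x * normH y by rewrite mulr_ge0 ?sqrtr_ge0.
  have -> : reH x x * reH y y = (normH x * normH y) ^+ 2.
    by rewrite exprMn !sqr_sqrtr// ; exact: B_ge0.
  by rewrite ltr_pXn2r// nnegrE // ltW // (le_lt_trans nn).
have P (s t : R) : 0 <= s ^+ 2 * reH x x + 2 * (s * t) * reH x y + t ^+ 2 * reH y y.
  rewrite (le_trans (B_ge0 (s%:C *: x + t%:C *: y)))//.
  rewrite BDl !BZl !(BC _ (_ + _)) !BDl !BZl (BC y x) le_eqVlt.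
  by apply/orP; left; apply/eqP; ring.
have [yy0|yy0] := eqVneq (reH y y) 0.
  have [->|xy0] := eqVneq (reH x y) 0; first by rewrite expr0n mulr_ge0.
  have := P (reH x y) (- (reH x x + 1) / 2); rewrite yy0.
  have := B_ge0 x; have : 0 < reH x y ^+ 2 by rewrite exprn_even_gt0.
  nra.
have y0 : 0 < reH y y by rewrite lt_def yy0 B_ge0.
rewrite -subr_ge0 -(pmulr_lge0 _ y0).
rewrite (le_trans (P (reH y y) (- reH x y)))// le_eqVlt; apply/orP; left; apply/eqP; ring.
Qed.

Lemma ler_normHD x y : normH (x + y) <= normH x + normH y.
Proof.
rewrite -(@ler_pXn2r _ 2)// ?nnegrE ?sqrtr_ge0 ?addr_ge0 ?sqrtr_ge0//.
have := CS x y; rewrite sqrrD !sqr_sqrtr; [|exact: B_ge0..].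
rewrite -!/(reH _ _) BDl !(BC _ (_ + _)) !BDl (BC y x); lra.
Qed.

Lemma normH0 : normH 0 = 0.
Proof.
rewrite /normH -/(reH 0 0); have := BZl 0 0 0.
by rewrite scaler0 mul0r => ->; rewrite sqrtr0.
Qed.

Lemma normHN x : normH (- x) = normH x.
Proof.
have e : - x = (-1)%:C *: x by rewrite rmorphN1 scaleN1r.
rewrite /normH -!/(reH _ _) {1}e BZl BC e BZl; congr Num.sqrt; ring.
Qed.

Definition ballH x (e : R) y := normH (x - y) < e.

Let ballH_center x e : 0 < e -> ballH x e x.
Proof. by rewrite /ballH subrr normH0. Qed.

Let ballH_sym x y e : ballH x e y -> ballH y e x.
Proof. by rewrite /ballH -normHN opprB. Qed.

Let ballH_triangle x y z e1 e2 :
  ballH x e1 y -> ballH y e2 z -> ballH x (e1 + e2) z.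
Proof.
rewrite /ballH => h1 h2; rewrite -(subrKA y).
exact: le_lt_trans (ler_normHD _ _) (ltrD h1 h2).
Qed.

HB.instance Definition _ := hasNbhs.Build (H0 R) (nbhs_ (entourage_ ballH)).

HB.instance Definition _ := @Nbhs_isPseudoMetric.Build R (H0 R)
  (entourage_ ballH) erefl ballH ballH_center ballH_sym ballH_triangle erefl.

End ComplexStructure.
Section SineBasis.
Variable R : realType.

Definition sine (k : nat) (t : R) : R := Num.sqrt (2 / pi) * sin (k%:R * t).

Lemma sine_Lfun k : sine k \in Lfun (mu0pi R) 2%:E.
Proof.
have ms : measurable_fun [set: R] (sine k).
  apply: continuous_measurable_fun => t; apply: cvgM; first exact: cvg_cst.
  apply: (@cvg_comp _ _ _ (fun u : R => k%:R * u) sin).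
    by apply: cvgM; [exact: cvg_cst | exact: cvg_id].
  exact: continuous_sin.
rewrite inE; apply/andP; split; rewrite inE//= /finite_norm unlock /Lnorm.
rewrite poweR_lty//.
have mu_fin : (mu0pi R setT < +oo)%E.
  by rewrite /mu0pi/= /mrestr setTI lebesgue_measure_itv/= lte_fin pi_gt0 -EFinD ltry.
apply: (@le_lt_trans _ _ (\int[mu0pi R]_x (cst (Num.sqrt (2 / pi) `^ 2)%:E) x)%E).
  apply: ge0_le_integral => //=.
  - apply/measurable_EFinP; apply: (measurableT_comp (measurable_powR _)) => //.
    exact: measurableT_comp.
  - move=> x _; rewrite lee_fin ge0_ler_powR ?nnegrE ?normr_ge0 ?sqrtr_ge0//.
    rewrite normrM ger0_norm ?sqrtr_ge0// ler_piMr ?sqrtr_ge0// ler_norml.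
    by rewrite sin_geN1 sin_le1.
by rewrite integral_cst// lte_mul_pinfty// lee_fin powR_ge0.
Qed.

Definition e_ k : U0 R := Lfun_Sub (lee1n 2) (sine_Lfun k).

End SineBasis.
Notation toH f := ((f, 0) : H0 _).

Section Spaces.
Variable R : realType.
Implicit Types (f g : U0 R) (x y z : H0 R).

Definition test_function (phi : R -> R) : Prop :=
  (forall n t, derivable (derive1n n phi) t 1) /\
  exists a b, [/\ 0 < a, b < pi & forall t, ~~ (a <= t <= b) -> phi t = 0].

Definition weak_derivative f g : Prop := forall phi, test_function phi ->
  \int[mu0pi R]_t (f t * derive1 phi t) = - \int[mu0pi R]_t (g t * phi t).

(* The boundary values are those of the continuous representative. *)
Definition H10 f : Prop :=
  (exists g, weak_derivative f g) /\
  exists h : R -> R, [/\ {within `[0, pi], continuous h},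
    (f : R -> R) = h %[ae mu0pi R], h 0 = 0 & h pi = 0].

Definition laplacian f g : Prop :=
  H10 f /\ exists2 f', weak_derivative f f' & weak_derivative f' g.

(* Graph of the Dirichlet Laplacian. *)
Definition laplacianH x y : Prop := laplacian x.1 y.1 /\ laplacian x.2 y.2.

Definition PM (M : nat) x : H0 R :=
  \sum_(1 <= k < M.+1) ipH x (toH (e_ R k)) *: toH (e_ R k).

Definition HM (M : nat) x : Prop :=
  exists c : nat -> R[i], x =h \sum_(1 <= k < M.+1) c k *: toH (e_ R k).

End Spaces.

Section Operators.
Variable R : realType.

Record linearU (A : U0 R -> U0 R) : Prop := {
  linearU_ae : forall f g, f =u g -> A f =u A g;
  linearU_linear : forall (c : R) f g, A (c *: f + g) =u (c *: A f + A g) }.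

Record linearH (A : H0 R -> H0 R) : Prop := {
  linearH_ae : forall x y, x =h y -> A x =h A y;
  linearH_linear : forall (c : R[i]) x y,
    A (c *: x + y) =h (c *: A x + A y) }.

Record nonneg_symmetricU (A : U0 R -> U0 R) : Prop := {
  nsU_linear : linearU A;
  nsU_symmetric : forall f g, ipU (A f) g = ipU f (A g);
  nsU_ge0 : forall f, 0 <= ipU (A f) f }.

Record nonneg_symmetricH (A : H0 R -> H0 R) : Prop := {
  nsH_linear : linearH A;
  nsH_symmetric : forall x y, ipH (A x) y = ipH x (A y);
  nsH_ge0 : forall x, 0 <= ipH (A x) x }.

(* S = A^{1/2}: the nonnegative symmetric square root. *)
Definition sqrt_opU (A S : U0 R -> U0 R) : Prop :=
  nonneg_symmetricU S /\ forall f, S (S f) =u A f.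

Definition sqrt_opH (A S : H0 R -> H0 R) : Prop :=
  nonneg_symmetricH S /\ forall x, S (S x) =h A x.

Definition extH (A : U0 R -> U0 R) : H0 R -> H0 R := fun x => (A x.1, A x.2).

(* Bounded from L^2 to H^1, with square-summable H^1 norms along the orthonormal
   basis (e_k) of L^2. *)
Definition hilbert_schmidt_U0_U1 (S : U0 R -> U0 R) : Prop :=
  exists D : U0 R -> U0 R,
  [/\ forall f, weak_derivative (S f) (D f),
      exists C : R, forall f,
        normU (S f) ^+ 2 + normU (D f) ^+ 2 <= C * normU f ^+ 2 &
      (\sum_(1 <= k <oo)
        (normU (S (e_ R k)) ^+ 2 + normU (D (e_ R k)) ^+ 2)%:E < +oo)%E].

(* E t = e^{i t Delta}: the C_0-group generated by i Delta. *)
Record schrodinger_group (E : R -> H0 R -> H0 R) : Prop := {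
  sg_linear : forall t, linearH (E t);
  sg_bounded : forall t, exists C : R, forall x, normH (E t x) <= C * normH x;
  sg0 : forall x, E 0 x =h x;
  sgD : forall s t x, E (s + t) x =h E s (E t x);
  sg_continuous : forall x, continuous (fun t => E t x);
  sg_generator : forall x y, laplacianH x y <->
    (t^-1)%:C *: (E t x - x) @[t --> 0^'] --> 'i%C *: y }.

End Operators.

Section Probability.
Variables (R : realType) (d : measure_display) (Omega : measurableType d).
Variable P : probability Omega R.

Definition independent_family (F : nat -> set (set Omega)) : Prop :=
  forall (s : seq nat) (A : nat -> set Omega), uniq s ->
    (forall k, k \in s -> F k (A k)) ->
    P (\bigcap_(k in [set` s]) A k) = (\prod_(k <- s) P (A k))%E.

Definition sigma_rv (X : Omega -> R) : set (set Omega) :=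
  [set A | exists2 B : set R, measurable B & A = X @^-1` B].

Definition sigma_process (b : R -> Omega -> R) : set (set Omega) :=
  <<s [set A | exists2 t, 0 <= t & sigma_rv (b t) A] >>.

Record brownian_motion (b : R -> Omega -> R) : Prop := {
  bm_measurable : forall t, 0 <= t -> measurable_fun setT (b t);
  bm0 : {ae P, forall w, b 0 w = 0};
  bm_increment : forall s t (B : set R), 0 <= s -> s < t -> measurable B ->
    P ((fun w => b t w - b s w) @^-1` B) = normal_prob 0 (Num.sqrt (t - s)) B;
  bm_independent : forall tau : nat -> R, 0 <= tau 0%N ->
    {homo tau : m n / (m <= n)%N >-> m <= n} ->
    independent_family (fun n => sigma_rv (fun w => b (tau n.+1) w - b (tau n) w));
  bm_continuous : {ae P, forall w, {within `[0, +oo[, continuous (b ^~ w)}} }.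

Definition random_variable (X : Omega -> H0 R) : Prop :=
  forall G : set (H0 R), open G -> measurable (X @^-1` G).

(* W(t) = \sum_(k >= 1) sqrt(eta_k) beta_k(t) e_k with independent Brownian
   motions beta_k, k >= 1. *)
Record wiener_process (eta : nat -> R) (beta : nat -> R -> Omega -> R)
    (W : R -> Omega -> U0 R) : Prop := {
  wp_beta : forall k, (0 < k)%N -> brownian_motion (beta k);
  wp_independent : independent_family (fun k => sigma_process (beta k.+1));
  wp_rv : forall t, 0 <= t -> random_variable (fun w => toH (W t w));
  wp_series : forall t, 0 <= t -> {ae P, forall w,
    normU (W t w - \sum_(1 <= k < n.+1) (Num.sqrt (eta k) * beta k t w) *: e_ R k)
      @[n --> \oo] --> 0};
  wp_continuous : {ae P, forall w,
    {within `[0, +oo[, continuous (fun t => toH (W t w))}} }.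

(* J = \int_0^t Phi(s) dW(s) for a strongly continuous deterministic Phi: the
   L^2(Omega; H^0)-limit of the elementary integrals along uniform partitions. *)
Definition wiener_integral (W : R -> Omega -> U0 R) (Phi : R -> H0 R -> H0 R)
    (t : R) (J : Omega -> H0 R) : Prop :=
  random_variable J /\
  (\int[P]_w ((normH (J w - \sum_(0 <= j < n.+1)
     Phi (t * j%:R / n.+1%:R)
       (toH (W (t * j.+1%:R / n.+1%:R) w - W (t * j%:R / n.+1%:R) w)))) ^+ 2)%:E)%E
    @[n --> \oo] --> (0%R%:E : \bar R).

Definition mild_solution (alpha : R) (u0 : H0 R) (E : R -> H0 R -> H0 R)
    (W : R -> Omega -> U0 R) (u : R -> Omega -> H0 R) : Prop :=
  forall t, 0 <= t -> random_variable (u t) /\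
    exists2 J, wiener_integral W (fun s => E (t - s)) t J &
      {ae P, forall w, u t w =h (E t u0 + ('i%C * alpha%:C) *: J w)}.

(* K = \int_0^t L(s) ds, characterized by pairing with every y in H^0; the real
   part suffices since y ranges over a complex space. *)
Definition time_integral (L : R -> H0 R) (t : R) (K : H0 R) : Prop :=
  forall y, complex.Re (ipH K y) =
    \int[lebesgue_measure]_(s in `[0, t]) complex.Re (ipH (L s) y).

Definition galerkin_solution (alpha : R) (u0 : H0 R)
    (W : R -> Omega -> U0 R) (M : nat) (v : R -> Omega -> H0 R) : Prop :=
  (forall t, 0 <= t -> random_variable (v t)) /\
  {ae P, forall w, {within `[0, +oo[, continuous (v ^~ w)} /\
    exists2 L : R -> H0 R,
      forall s, 0 <= s -> laplacianH (PM M (v s w)) (L s) &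
      forall t, 0 <= t -> exists2 K, time_integral L t K &
        v t w =h (PM M u0 + 'i%C *: K + ('i%C * alpha%:C) *: PM M (toH (W t w)))}.

(* The speed is T, T -> +oo. *)
Record LDP (Z : R -> Omega -> H0 R) (I : H0 R -> \bar R) : Prop := {
  ldp_ge0 : forall x, (0 <= I x)%E;
  ldp_lsc : lower_semicontinuous I;
  ldp_open : forall G : set (H0 R), open G ->
    (- ereal_inf (I @` G) <=
       limf_einf (fun T : R => (T^-1)%:E * lne (P (Z T @^-1` G))) +oo%R)%E;
  ldp_closed : forall C : set (H0 R), closed C ->
    (limf_esup (fun T : R => (T^-1)%:E * lne (P (Z T @^-1` C))) +oo%R
       <= - ereal_inf (I @` C))%E }.

End Probability.

Definition scaled_process (R : realType) (Omega : Type)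
    (u : R -> Omega -> H0 R) (T : R) (w : Omega) : H0 R := (T^-1)%:C *: u T w.

Section RateFunction.
Variable R : realType.

Definition min_norm_preimage (A : H0 R -> H0 R) (D : set (H0 R)) (x z : H0 R) :=
  [/\ D z, A z =h x & forall y, D y -> A y =h x -> normH z <= normH y].

Definition pseudo_inverse (A : H0 R -> H0 R) (D : set (H0 R)) (x : H0 R) : H0 R :=
  xget 0 [set z | min_norm_preimage A D x z].

(* alpha^-2 |A^{-1} x|^2 on the range of A, +oo elsewhere; A^{-1} x is the element
   of minimal norm in D which A maps to x. *)
Definition gaussian_rate (alpha : R) (A : H0 R -> H0 R) (D : set (H0 R))
    (x : H0 R) : \bar R :=
  if `[< exists z, A z =h x >] then
    ((alpha ^+ 2)^-1 * normH (pseudo_inverse A D x) ^+ 2)%:E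
  else +oo%E.

End RateFunction.

(* Main.v *)
Require Import Defs.
From HB Require Import structures.
From mathcomp Require Import all_boot all_order all_algebra.
From mathcomp Require Import complex.
From mathcomp Require Import ring lra.
From mathcomp Require Import all_classical all_reals all_analysis.
From mathcomp Require Import measurable_realfun.

Set Implicit Arguments.
Unset Strict Implicit.
Unset Printing Implicit Defensive.

Import Order.TTheory GRing.Theory Num.Theory.
Import numFieldNormedType.Exports.

Local Open Scope classical_set_scope.
Local Open Scope ring_scope.

(** Rate functions of large deviations principles are unique, so I and I^M are
    the Gaussian rates. Write S = Q^{1/2}. Because eta is nonincreasing, a
    preimage z of x under S can be chosen with no component along the e_k with
    eta_k = 0; it then has minimal norm, so I(x) = |z|^2 / alpha^2. Take
    x0 = Q_M^{1/2} P_M z = S P_M z. For the same reason P_M z is the minimal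
    preimage of x0, whence I(x) - I^M(x0) = |z - P_M z|^2 / alpha^2, while
    |x - x0| <= |S| |z - P_M z|. Both tend to 0 since the sines span a dense
    subspace of L^2(0, pi): products sin t * p(cos t) with p a polynomial are
    sine polynomials, suitable p approximate the steps 1_{cos t < c}, and the
    approximable functions sin * 1_A form a Dynkin class. *)

(** * Sine polynomials *)

Section SineSpan.
Variable R : realType.
Implicit Types (f g h : R -> R) (p : {poly R}).

Definition sine_span f : Prop :=
  exists n (c : nat -> R), forall t, f t = \sum_(k < n) c k * sin (k%:R * t).

Lemma sine_span_scale (a : R) f : sine_span f -> sine_span (fun t => a * f t).
Proof.
move=> [n [c fE]]; exists n, (fun k => a * c k) => t.
by rewrite fE mulr_sumr; apply: eq_bigr => k _; rewrite mulrA.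
Qed.

Lemma sine_spanD f g : sine_span f -> sine_span g ->
  sine_span (fun t => f t + g t).
Proof.
move=> [n [c fE]] [m [e gE]].
exists (n + m)%N, (fun k => (if (k < n)%N then c k else 0) +
  (if (k < m)%N then e k else 0)) => t.
under eq_bigr do rewrite mulrDl.
rewrite big_split/= fE gE; congr +%R.
- rewrite (big_ord_widen (n + m) (fun k => c k * sin (k%:R * t)))/= ?leq_addr//.
  by rewrite big_mkcond; apply: eq_bigr => k _; case: ifP; rewrite // mul0r.
- rewrite (big_ord_widen (n + m) (fun k => e k * sin (k%:R * t)))/= ?leq_addl//.
  by rewrite big_mkcond; apply: eq_bigr => k _; case: ifP; rewrite // mul0r.
Qed.

Lemma sine_span_sin k : sine_span (fun t => sin (k%:R * t)).
Proof.
exists k.+1, (fun j => (j == k)%:R) => t.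
rewrite big_ord_recr/= eqxx mul1r big1 ?add0r// => j _.
by rewrite (ltn_eqF (ltn_ord j)) mul0r.
Qed.

Lemma sine_span_sum (I : Type) (s : seq I) (F : I -> R -> R) :
  (forall i, sine_span (F i)) -> sine_span (fun t => \sum_(i <- s) F i t).
Proof.
move=> hF; elim: s => [|i s IH].
  by exists 0%N, (fun=> 0) => t; rewrite big_nil big_ord0.
have [n [c E]] := sine_spanD (hF i) IH; exists n, c => t.
by rewrite big_cons E.
Qed.

Lemma sine_span_mulcos f : sine_span f -> sine_span (fun t => f t * cos t).
Proof.
move=> [n [c fE]].
suff h k : sine_span (fun t => sin (k%:R * t) * cos t).
  have [m [e E]] := sine_span_sum (index_enum 'I_n)
    (fun i : 'I_n => sine_span_scale (c i) (h i)).
  exists m, e => t; rewrite -E fE mulr_suml.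
  by apply: eq_bigr => i _; rewrite mulrA.
case: k => [|k].
  by exists 0%N, (fun=> 0) => t; rewrite big_ord0 mul0r sin0 mul0r.
have [n' [c' E]] := sine_spanD
  (sine_span_scale (1/2) (sine_span_sin k.+2)) (sine_span_scale (1/2) (sine_span_sin k)).
exists n', c' => t; rewrite -E.
have -> : k.+2%:R * t = k.+1%:R * t + t by rewrite -[in LHS]addn1 natrD; ring.
have -> : k%:R * t = k.+1%:R * t - t by rewrite -[k.+1]addn1 natrD; ring.
by rewrite sinD sinB; field.
Qed.

Lemma sine_span_poly p : sine_span (fun t => sin t * p.[cos t]).
Proof.
elim/poly_ind: p => [|p c IH].
  by exists 0%N, (fun=> 0) => t; rewrite big_ord0 horner0 mulr0.
have [n [e E]] := sine_spanD (sine_span_mulcos IH) (sine_span_scale c (sine_span_sin 1)).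
exists n, e => t; rewrite -E !hornerE ?mul1r; ring.
Qed.

Lemma continuous_sine_span f : sine_span f -> continuous f.
Proof.
move=> [n [c fE]] t; rewrite (_ : f = fun t => \sum_(k < n) c k * sin (k%:R * t)).
  apply: cvg_big => [|k _]; first exact: add_continuous.
  apply: cvgM; first exact: cvg_cst.
  apply: (@cvg_comp _ _ _ (fun u : R => k%:R * u) sin).
    by apply: cvgM; [exact: cvg_cst | exact: cvg_id].
  exact: continuous_sin.
by apply/funext => s; rewrite fE.
Qed.

Lemma measurable_sine_span f : sine_span f -> measurable_fun setT f.
Proof. by move=> /continuous_sine_span; exact: continuous_measurable_fun. Qed.

End SineSpan.

(** * Density of the sines in L^2(0, pi) *)

Section SineApproximation.
Variable R : realType.
Let mu := mu0pi R.
Implicit Types (f g h : R -> R) (e : R).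

Definition sq_dist f g : \bar R := (\int[mu]_x ((f x - g x) ^+ 2)%:E)%E.

Definition sine_approx f : Prop := measurable_fun setT f /\
  forall e, 0 < e -> exists2 g, sine_span g & (sq_dist f g < e%:E)%E.

Lemma ae_mu0pi (P : R -> Prop) :
  (forall x, 0 < x < pi -> P x) -> {ae mu, forall x, P x}.
Proof.
move=> hP; exists (~` `]0, pi[%classic); split.
- by apply: measurableC; exact: measurable_itv.
- by rewrite /mu /mu0pi /= /mrestr setICl measure0.
- by move=> x /= nPx; rewrite in_itv/= => xpi; apply: nPx; exact: hP.
Qed.

Let measurable_sqr_sub f g : measurable_fun setT f -> measurable_fun setT g ->
  measurable_fun setT (fun x => ((f x - g x) ^+ 2)%:E).
Proof.
move=> mf mg; apply/measurable_EFinP.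
by apply: measurable_funX; exact: measurable_funB.
Qed.

Lemma sq_dist_triangle f g h : measurable_fun setT f ->
  measurable_fun setT g -> measurable_fun setT h ->
  (sq_dist f h <= 2%:E * (sq_dist f g + sq_dist g h))%E.
Proof.
move=> mf mg mh; rewrite /sq_dist -ge0_integralD//; last 4 first.
- by move=> x _; rewrite lee_fin sqr_ge0.
- exact: measurable_sqr_sub.
- by move=> x _; rewrite lee_fin sqr_ge0.
- exact: measurable_sqr_sub.
rewrite -ge0_integralZl//; last 2 first.
- by apply: emeasurable_funD; exact: measurable_sqr_sub.
- by move=> x _; rewrite -EFinD lee_fin addr_ge0 ?sqr_ge0.
apply: ge0_le_integral => //.
- by move=> x _; rewrite lee_fin sqr_ge0.
- exact: measurable_sqr_sub.
- apply: measurable_funeM; apply: emeasurable_funD; exact: measurable_sqr_sub.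
move=> x _; rewrite -EFinD -EFinM lee_fin.
have := sqr_ge0 (f x - 2 * g x + h x); nra.
Qed.

Lemma sine_span_approx f : sine_span f -> sine_approx f.
Proof.
move=> sf; split; first exact: measurable_sine_span.
move=> e e0; exists f => //; rewrite /sq_dist.
by under eq_integral do rewrite subrr expr0n/=; rewrite integral0 lte_fin.
Qed.

Lemma sine_approx_lim f : measurable_fun setT f ->
  (forall e, 0 < e -> exists2 g, sine_approx g & (sq_dist f g < e%:E)%E) ->
  sine_approx f.
Proof.
move=> mf lf; split => // e e0.
have e4 : 0 < e / 4 by rewrite divr_gt0.
have [g [mg ag] fg] := lf _ e4; have [h sh gh] := ag _ e4.
exists h => //; apply: le_lt_trans (sq_dist_triangle mf mg (measurable_sine_span sh)) _.
apply: (@lt_le_trans _ _ (2%:E * ((e/4)%:E + (e/4)%:E))%E); last first.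
  by rewrite -EFinD -EFinM lee_fin; lra.
by rewrite lte_pmul2l// lteD.
Qed.

Lemma sine_approxZ (a : R) f : sine_approx f -> sine_approx (fun t => a * f t).
Proof.
move=> [mf af]; split; first exact: measurable_funM.
move=> e e0; have b0 : 0 < a ^+ 2 + 1 by rewrite ltr_wpDl// sqr_ge0.
have [g sg fg] := af (e / (a ^+ 2 + 1)) (divr_gt0 e0 b0).
exists (fun t => a * g t); first exact: sine_span_scale.
apply: (@le_lt_trans _ _ ((a ^+ 2 + 1)%:E * sq_dist f g)%E); last first.
  have -> : e%:E = ((a ^+ 2 + 1)%:E * (e / (a ^+ 2 + 1))%:E)%E.
    by rewrite -EFinM mulrCA divff ?mulr1// gt_eqF.
  by rewrite lte_pmul2l.
have mg := measurable_sine_span sg.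
rewrite /sq_dist -ge0_integralZl//; last 3 first.
- exact: measurable_sqr_sub.
- by move=> x _; rewrite lee_fin sqr_ge0.
- by rewrite lee_fin ltW.
apply: ge0_le_integral => //.
- by move=> x _; rewrite lee_fin sqr_ge0.
- by apply: measurable_sqr_sub; exact: measurable_funM.
- by apply: measurable_funeM; exact: measurable_sqr_sub.
move=> x _; rewrite -EFinM lee_fin.
have := sqr_ge0 (f x - g x); nra.
Qed.

Lemma sine_approxD f g : sine_approx f -> sine_approx g ->
  sine_approx (fun t => f t + g t).
Proof.
move=> [mf af] [mg ag]; split; first exact: measurable_funD.
move=> e e0; have e4 : 0 < e / 4 by rewrite divr_gt0.
have [f' sf ff'] := af _ e4; have [g' sg gg'] := ag _ e4.
exists (fun t => f' t + g' t); first exact: sine_spanD.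
have mf' := measurable_sine_span sf; have mg' := measurable_sine_span sg.
apply: (@le_lt_trans _ _ (2%:E * (sq_dist f f' + sq_dist g g'))%E); last first.
  apply: (@lt_le_trans _ _ (2%:E * ((e/4)%:E + (e/4)%:E))%E); last first.
    by rewrite -EFinD -EFinM lee_fin; lra.
  by rewrite lte_pmul2l// lteD.
apply: (le_trans (@sq_dist_triangle _ (fun t => f' t + g t) _ _ _ _));
  [exact: measurable_funD..|].
rewrite lee_pmul2l// leeD//.
- by rewrite le_eqVlt; apply/orP; left; apply/eqP/eq_integral => x _; congr EFin; ring.
- by rewrite le_eqVlt; apply/orP; left; apply/eqP/eq_integral => x _; congr EFin; ring.
Qed.

Lemma sine_approx_sum (I : Type) (s : seq I) (F : I -> R -> R) :
  (forall i, sine_approx (F i)) -> sine_approx (fun t => \sum_(i <- s) F i t).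
Proof.
move=> hF; elim: s => [|i s IH].
  rewrite (_ : (fun _ => _) = fun=> 0); last by apply/funext => t; rewrite big_nil.
  by apply: sine_span_approx; exists 0%N, (fun=> 0) => t; rewrite big_ord0.
rewrite (_ : (fun _ => _) = fun t => F i t + \sum_(i <- s) F i t).
  exact: sine_approxD.
by apply/funext => t; rewrite big_cons.
Qed.

Lemma eq_sine_approx f g : measurable_fun setT g ->
  (forall x, 0 < x < pi -> f x = g x) -> sine_approx f -> sine_approx g.
Proof.
move=> mg fg [mf af]; split => // e e0; have [h sh fh] := af _ e0.
exists h => //; rewrite (_ : sq_dist g h = sq_dist f h)//.
have mh := measurable_sine_span sh.
apply: ae_eq_integral => //; [exact: measurable_sqr_sub..|].
by apply: ae_mu0pi => x x0pi _; rewrite fg.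
Qed.

Lemma sine_approx_dominated (f_ : nat -> R -> R) f G :
  (forall n, sine_approx (f_ n)) -> measurable_fun setT f ->
  mu.-integrable setT (fun x => (G x ^+ 2)%:E) ->
  (forall x, 0 < x < pi -> f_ ^~ x @ \oo --> f x) ->
  (forall n x, 0 < x < pi -> `|f_ n x| <= G x) ->
  sine_approx f.
Proof.
move=> af mf iG cf fG; apply: sine_approx_lim => // e e0.
suff : sq_dist f (f_ n) @[n --> \oo] --> (0 : \bar R).
  move=> /fine_cvgP[fin c0].
  have [n _ /(_ n (leqnn n)) [nfin h]] : \forall n \near \oo,
      sq_dist f (f_ n) \is a fin_num /\ `|0 - fine (sq_dist f (f_ n))| < e.
    by near=> n; split; near: n => //; move/cvgrPdist_lt : c0; exact.
  exists (f_ n) => //; rewrite -(fineK nfin) lte_fin.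
  by move: h; rewrite sub0r normrN; apply: le_lt_trans; exact: ler_norm.
have fleG x : 0 < x < pi -> `|f x| <= G x.
  move=> x0; apply: (@ler_cvg_to _ \oo _ _ (fun n => `|f_ n x|) (fun=> G x)).
  - by apply: cvg_norm; exact: cf.
  - exact: cvg_cst.
  - by near=> n; exact: fG.
have := @dominated_convergence _ _ R mu setT measurableT
  (fun n x => ((f x - f_ n x) ^+ 2)%:E) (cst 0%E) (fun x => (4%:E * (G x ^+ 2)%:E)%E).
case.
- by move=> n; apply: measurable_sqr_sub => //; case: (af n).
- exact: measurable_cst.
- apply: ae_mu0pi => x x0 _; apply/fine_cvgP; split; first by near=> n.
  rewrite [X in _ --> X](_ : _ = (f x - f x) ^+ 2); last by rewrite subrr expr0n.
  by rewrite expr2; apply: cvgM; apply: cvgB; [exact: cvg_cst|exact: cf|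
    exact: cvg_cst|exact: cf].
- exact: integrableZl.
- apply: ae_mu0pi => x x0 n _; rewrite gee0_abs ?lee_fin ?sqr_ge0//.
  have := fleG _ x0; have := fG n _ x0; rewrite !ler_norml => /andP[? ?] /andP[? ?].
  nra.
move=> _ _; rewrite integral0; exact.
Unshelve. all: by end_near.
Qed.

End SineApproximation.

Section SineDensity.
Variable R : realType.
Let mu := mu0pi R.
Implicit Types (f g h : R -> R) (c q x t : R).

Lemma mulrn_expr_le (s : R) n : 0 <= s -> s < 1 -> n%:R * s ^+ n <= (1 - s)^-1.
Proof.
move=> s0 s1; have b0 : 0 < 1 - s by rewrite subr_gt0.
rewrite -[leRHS]mul1r ler_pdivlMr//.
suff : n%:R * (1 - s) * s ^+ n <= 1 - s ^+ n.
  have : 0 <= s ^+ n by exact: exprn_ge0.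
  nra.
elim: n => [|n IH]; first by rewrite !mul0r expr0 subrr.
have : s ^+ n <= 1 by apply: exprn_ile1 => //; exact: ltW.
have : 0 <= s ^+ n by exact: exprn_ge0.
rewrite exprS -[n.+1]addn1 natrD; set N := n%:R; set S := s ^+ n in IH * => S0 S1.
have := ler_wpM2l s0 IH.
have : 0 <= (1 - s) * (1 - s * S).
  by rewrite mulr_ge0// ?subr_ge0 ?mulr_ile1//; exact: ltW.
nra.
Qed.

Lemma subr1X_ge (a : R) n : 0 <= a <= 1 -> 1 - n%:R * a <= (1 - a) ^+ n.
Proof.
move=> /andP[a0 a1]; elim: n => [|n IH]; first by rewrite mul0r subr0.
have : 0 <= n%:R :> R by [].
rewrite exprS -[n.+1]addn1 natrD; set N := n%:R; set S := _ ^+ n in IH *.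
nra.
Qed.

Lemma subr1X_le (a : R) n : 0 <= a <= 1 -> (1 - a) ^+ n * (1 + n%:R * a) <= 1.
Proof.
move=> /andP[a0 a1]; elim: n => [|n IH]; first by rewrite mul0r addr0 mulr1.
have : 0 <= n%:R :> R by [].
have : 0 <= (1 - a) ^+ n by rewrite exprn_ge0// subr_ge0.
rewrite exprS -[n.+1]addn1 natrD; set N := n%:R; set S := _ ^+ n in IH *.
move=> S0 N0; have : 0 <= S * a by exact: mulr_ge0.
have : 0 <= S * a * (N * a) by rewrite !mulr_ge0.
have : 0 <= S * a * a by rewrite !mulr_ge0.
lra.
Qed.

(* Stone's trick: polynomials in [q] approximating a step at [q = 1/2]; the
   extra factor [n] in the exponent settles the value at the jump. *)
Definition stone_step n q : R := (1 - q ^+ n) ^+ (n * 2 ^ n).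

Lemma stone_step_bounds n q : 0 <= q <= 1 -> 0 <= stone_step n q <= 1.
Proof.
move=> /andP[q0 q1]; have h : 0 <= 1 - q ^+ n <= 1.
  by rewrite subr_ge0 exprn_ile1//= lerBlDr lerDl exprn_ge0.
move/andP: h => [h0 h1].
by rewrite /stone_step exprn_ge0//= exprn_ile1.
Qed.

Lemma cvg_stone_step_lt q : 0 <= q < 1 / 2 -> stone_step ^~ q @ \oo --> (1 : R).
Proof.
move=> /andP[q0 q2].
have [r [r0 r1 r2]] : exists r, [/\ 0 <= r, r < 1 & 2 * q = r ^+ 2].
  exists (Num.sqrt (2 * q)); split => //.
  - by rewrite -[ltRHS]sqrtr1 ltr_sqrt//; lra.
  - by rewrite sqr_sqrtr//; lra.
apply: (@squeeze_cvgr nat \oo _ R (fun n => 1 - (1 - r)^-1 * r ^+ n) (fun=> 1)).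
- near=> n; have /andP[_ ->] := @stone_step_bounds n q ltac:(lra).
  rewrite andbT; apply: le_trans (subr1X_ge _ _); last first.
    by rewrite exprn_ge0//= exprn_ile1//; lra.
  rewrite lerD2l lerN2 natrM natrX -mulrA -exprMn r2 -exprM mulnC exprM expr2.
  by rewrite mulrA ler_wpM2r ?exprn_ge0// mulrn_expr_le.
- rewrite -[X in _ --> X]subr0 -(mulr0 (1 - r)^-1).
  apply: cvgB; first exact: cvg_cst.
  apply: cvgM; first exact: cvg_cst.
  by apply: cvg_expr; rewrite ger0_norm.
- exact: cvg_cst.
Unshelve. all: by end_near. Qed.

Lemma cvg_stone_step_ge q : 1 / 2 <= q <= 1 -> stone_step ^~ q @ \oo --> (0 : R).
Proof.
move=> /andP[q2 q1].
apply: (@squeeze_cvgr nat \oo _ R (fun=> 0) (fun n => n.+1%:R^-1)).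
- near=> n; have /andP[-> _] /= := @stone_step_bounds n q ltac:(lra).
  have /(subr1X_le (n * 2 ^ n)) : 0 <= q ^+ n <= 1.
    by rewrite exprn_ge0//= ?exprn_ile1//; lra.
  rewrite -/(stone_step n q) => h.
  rewrite -[leRHS]mul1r ler_pdivlMr//; apply: le_trans h.
  have /andP[s0 _] := @stone_step_bounds n q ltac:(lra).
  rewrite ler_wpM2l// -[n.+1]add1n natrD lerD2l natrM natrX -mulrA -exprMn.
  by rewrite ler_peMr// exprn_ege1//; lra.
- exact: cvg_cst.
- exact: cvg_harmonic.
Unshelve. all: by end_near. Qed.

Lemma mu0pi_fin : (mu setT < +oo)%E.
Proof.
by rewrite /mu/= /mrestr setTI lebesgue_measure_itv/= lte_fin pi_gt0 -EFinD ltry.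
Qed.

Lemma integrable_cst_mu0pi c : mu.-integrable setT (fun=> c%:E).
Proof.
apply/integrableP; split; first exact: measurable_cst.
rewrite [X in (X < _)%E](_ : _ = (`|c|%:E * mu setT)%E); last first.
  by rewrite -integral_cst.
by rewrite lte_mul_pinfty// ?lee_fin// mu0pi_fin.
Qed.

Let measurable_sin : measurable_fun setT (@sin R).
Proof. by apply: continuous_measurable_fun; exact: continuous_sin. Qed.

Let measurable_cos : measurable_fun setT (@cos R).
Proof. by apply: continuous_measurable_fun; exact: continuous_cos. Qed.

Let sin_le1_norm x : `|sin x| <= 1 :> R.
Proof. by rewrite ler_norml sin_geN1 sin_le1. Qed.

Lemma sine_approx_cos_ray c : -1 <= c <= 1 ->
  sine_approx (fun t => sin t * \1_[set t | cos t < c] t).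
Proof.
move=> /andP[c1 c2]; pose q t : R := 1 / 2 + (cos t - c) / 4.
have q01 t : 0 <= q t <= 1.
  by have := cos_geN1 t; have := cos_le1 t; rewrite /q; lra.
apply: (@sine_approx_dominated _ (fun n t => sin t * stone_step n (q t)) _ (fun=> 1)).
- move=> n; apply: sine_span_approx.
  have [m [e E]] := sine_span_poly
    ((1 - ((1 / 2)%:P + ('X - c%:P) * (1 / 4)%:P) ^+ n) ^+ (n * 2 ^ n)).
  by exists m, e => t; rewrite -E !hornerE/= /stone_step /q mulr1 div1r.
- apply: measurable_funM => //; apply: measurable_indic.
  rewrite -[X in measurable X]setTI.
  by have := measurable_cos measurableT (measurable_itv `]-oo, c[).
- by rewrite expr1n; exact: integrable_cst_mu0pi.
- move=> t _; apply: cvgM; first exact: cvg_cst.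
  rewrite indicE; have [tc|tc] := ltP (cos t) c.
  + rewrite mem_set//=; apply: cvg_stone_step_lt.
    by have /andP[-> _] := q01 t; rewrite /q /=; lra.
  + rewrite memNset/=; last by apply/negP; rewrite -leNgt.
    apply: cvg_stone_step_ge.
    by have /andP[_ ->] := q01 t; rewrite andbT /q; lra.
- move=> n t _; rewrite normrM [X in _ * X]ger0_norm; last first.
    by case/andP: (stone_step_bounds n (q01 t)).
  rewrite -[leRHS]mulr1 ler_pM//; by case/andP: (stone_step_bounds n (q01 t)).
Qed.

Let sine_approx_sin : sine_approx (@sin R).
Proof.
apply: sine_span_approx; have [n [c E]] := sine_span_sin R 1.
by exists n, c => t; rewrite -E mul1r.
Qed.

Let sine_approx_ray x : sine_approx (fun t => sin t * \1_(`]x, +oo[) t).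
Proof.
have mx : measurable_fun setT (fun t => sin t * \1_(`]x, +oo[) t).
  by apply: measurable_funM => //; exact: measurable_indic.
have [x0|x0] := leP x 0.
  apply: eq_sine_approx (sine_approx_sin) => // t /andP[t0 _].
  by rewrite indicE mem_set ?mulr1//= in_itv/= andbT (le_lt_trans x0).
have [xpi|xpi] := leP pi x.
  apply: eq_sine_approx (sine_approxZ 0 sine_approx_sin) => // t /andP[_ tpi].
  rewrite indicE memNset ?mulr0 ?mul0r//= in_itv/= andbT.
  by apply/negP; rewrite -leNgt ltW// (lt_le_trans tpi).
apply: eq_sine_approx (sine_approx_cos_ray (c := cos x) _) => //; last first.
  by rewrite cos_geN1 cos_le1.
move=> t /andP[t0 tpi]; congr (_ * _); rewrite !indicE; congr (_%:R); congr nat_of_bool.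
by apply/idP/idP; rewrite !inE/= in_itv/= andbT ltr_cos// in_itv/= ?ltW.
Qed.

Lemma sine_approx_indic (A : set (measurableTypeR R)) : measurable A ->
  sine_approx (fun t => sin t * \1_A t).
Proof.
rewrite [measurable](RGenOInfty.measurableE R).
apply: (dynkin_induction (G := @RGenOInfty.G R)
  (P := fun A => sine_approx (fun t => sin t * \1_A t))).
- exact: RGenOInfty.measurableE.
- move=> _ _ [x ->] [y ->]; exists (Num.max x y).
  by apply/seteqP; split => t /=; rewrite !in_itv/= !andbT gt_max => /andP.
- rewrite (_ : (fun _ => _) = @sin R); first exact: sine_approx_sin.
  by apply/funext => t; rewrite indicE in_setT mulr1.
- by move=> _ [x ->]; exact: sine_approx_ray.
- move=> S _ aS; rewrite (_ : (fun _ => _) = fun t => sin t + (-1) * (sin t * \1_S t)).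
    by apply: sine_approxD => //; exact: sine_approxZ.
  apply/funext => t; rewrite !indicE in_setC; case: (t \in S) => /=; ring.
move=> F mF tF aF.
have FE n t k : F k t -> \sum_(0 <= i < n) \1_(F i) t = (k < n)%:R :> R.
  move=> Fkt; have F0 i : i != k -> \1_(F i) t = 0 :> R.
    move=> ik; rewrite indicE memNset// => Fit.
    by move/eqP : ik; apply; apply: (tF i k) => //; exists t.
  elim: n => [|n IH]; first by rewrite big_nil.
  rewrite big_nat_recr//= IH; have [nk|nk] := eqVneq n k.
    by rewrite nk ltnn add0r ltnSn indicE mem_set.
  by rewrite F0// addr0 ltnS (leq_eqVlt k n) eq_sym (negbTE nk).
have FN n t : ~ (\bigcup_k F k) t -> \sum_(0 <= i < n) \1_(F i) t = 0 :> R.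
  move=> nF; rewrite big1// => i _; rewrite indicE memNset// => Fit.
  by apply: nF; exists i.
apply: (@sine_approx_dominated _ (fun n t => sin t * \sum_(0 <= i < n) \1_(F i) t)
  _ (fun=> 1)).
- move=> n; rewrite (_ : (fun _ => _) =
      fun t => \sum_(i <- index_iota 0 n) (sin t * \1_(F i) t)).
    exact: sine_approx_sum.
  by apply/funext => t; rewrite mulr_sumr.
- apply: measurable_funM => //; apply: measurable_indic.
  exact: bigcup_measurable.
- by rewrite expr1n; exact: integrable_cst_mu0pi.
- move=> t _; apply: cvgM; first exact: cvg_cst.
  have [[k _ Fkt]|nF] := pselect ((\bigcup_k F k) t).
    rewrite indicE mem_set; last by exists k.
    apply: cvg_near_cst; near=> n; rewrite (FE _ _ _ Fkt).
    by rewrite (_ : (k < n)%N) //; near: n; exact: nbhs_infty_gt.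
  rewrite indicE memNset//; apply: cvg_near_cst; near=> n; exact: FN.
- move=> n t _; rewrite normrM -[leRHS]mulr1 ler_pM//.
  have [[k _ Fkt]|nF] := pselect ((\bigcup_k F k) t).
    by rewrite (FE _ _ _ Fkt); case: (_ < _)%N; rewrite ?normr1 ?normr0.
  by rewrite FN// normr0.
Unshelve. all: by end_near. Qed.

Import HBNNSimple.

Lemma sine_approx_nnsfun (s : {nnsfun R >-> R}) :
  sine_approx (fun t => sin t * s t).
Proof.
have [r sE] : exists r : seq R,
    forall t, s t = \sum_(y <- r) y * \1_(s @^-1` [set y]) t.
  by eexists => t; rewrite fimfunE fsbig_finite.
rewrite (_ : (fun _ => _) =
    fun t => \sum_(y <- r) (y * (sin t * \1_(s @^-1` [set y]) t))).
  apply: sine_approx_sum => y; apply: sine_approxZ; apply: sine_approx_indic.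
  by have := @measurable_sfunP _ _ _ R s [set y] (measurable_set1 y).
by apply/funext => t; rewrite sE mulr_sumr; apply: eq_bigr => y _; rewrite mulrCA.
Qed.

Lemma ge0_sine_approx f G : measurable_fun setT f -> (forall t, 0 <= f t) ->
  mu.-integrable setT (fun x => (G x ^+ 2)%:E) -> (forall t, f t <= G t) ->
  sine_approx f.
Proof.
move=> mf f0 iG fG; pose g t := f t * `|sin t| `^ (-1).
have g0 t : 0 <= g t by rewrite mulr_ge0// powR_ge0.
have mg : measurable_fun setT (EFin \o g).
  apply/measurable_EFinP; apply: measurable_funM => //.
  by apply: (measurableT_comp (measurable_powR _)) => //; exact: measurableT_comp.
have fE t : 0 < t < pi -> f t = sin t * g t.
  move=> /sin_gt0_pi st; rewrite /g powR_inv1 ?normr_ge0// gtr0_norm//.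
  by rewrite mulrCA divff ?mulr1// gt_eqF.
pose s := nnsfun_approx measurableT mg.
have sg t : s ^~ t @ \oo --> g t.
  have := @cvg_nnsfun_approx _ _ R setT measurableT _ mg
    (fun x _ => g0 x) t I.
  by move=> /fine_cvgP[_]; exact.
apply: (@sine_approx_dominated _ (fun n t => sin t * s n t) _ G) => //.
- by move=> n; exact: sine_approx_nnsfun.
- by move=> t /fE ->; apply: cvgM; [exact: cvg_cst|exact: sg].
- move=> n t t0; have := fG t; rewrite (fE t)//; apply: le_trans.
  have st := sin_gt0_pi t0; rewrite ger0_norm; last first.
    by rewrite mulr_ge0//; exact: ltW.
  rewrite ler_pM2l//; move: (sg t) => /cvg_lim <- //.
  apply: (@nondecreasing_cvgn_le _ (s ^~ t)); last by apply/cvg_ex; exists (g t); exact: sg.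
  by move=> m k mk; have /lefP := @nd_nnsfun_approx _ _ R _ measurableT _ mg m k mk; exact.
Qed.

Lemma L2_sine_approx f : measurable_fun setT f ->
  mu.-integrable setT (fun x => (f x ^+ 2)%:E) -> sine_approx f.
Proof.
move=> mf if2.
have i2 : mu.-integrable setT (fun x => (`|f x| ^+ 2)%:E).
  by rewrite (_ : (fun _ => _) = fun x => (f x ^+ 2)%:E)//;
    apply/funext => x; rewrite real_normK ?num_real.
have mn : measurable_fun setT (fun x => `|f x|) by exact: measurableT_comp.
rewrite (_ : f = fun x => (`|f x| + f x) / 2 + (-1) * ((`|f x| - f x) / 2)); last first.
  by apply/funext => x; field.
apply: sine_approxD; last apply: sine_approxZ.
- apply: (ge0_sine_approx _ _ i2).
  + by apply: measurable_funM => //; exact: measurable_funD.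
  + move=> t; have := ler_norm (- f t); rewrite normrN; lra.
  + move=> t; have := ler_norm (f t); lra.
- apply: (ge0_sine_approx _ _ i2).
  + by apply: measurable_funM => //; exact: measurable_funB.
  + move=> t; have := ler_norm (f t); lra.
  + move=> t; have := ler_norm (- f t); rewrite normrN; lra.
Qed.

End SineDensity.

(** * The orthonormal basis (e_k) *)

Section SineBasisU0.
Variable R : realType.
Let mu := mu0pi R.
Implicit Types (f g h : U0 R) (c : R).
Local Notation e := (e_ R).

Lemma U0_valD f g t : (f + g) t = f t + g t. Proof. by []. Qed.
Lemma U0_valN f t : (- f) t = - f t. Proof. by []. Qed.
Lemma U0_valZ c f t : (c *: f) t = c * f t. Proof. by []. Qed.
Definition U0_valE := (U0_valD, U0_valN, U0_valZ).

Lemma U0_val_sum (I : Type) (s : seq I) (F : I -> U0 R) t :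
  (\sum_(i <- s) F i) t = \sum_(i <- s) F i t.
Proof. by elim: s => [|i s IH]; rewrite ?big_nil// !big_cons U0_valD IH. Qed.

Lemma measurable_U0 f : measurable_fun setT (f : R -> R).
Proof. by have := LfunP f; rewrite inE => /andP[]; rewrite inE. Qed.

#[local] Instance ae_mu0pi_filter : Filter (nbhs (almost_everywhere (mu0pi R))) :=
  ae_filter_ringOfSetsType (mu0pi R).

Lemma eqU_refl f : f =u f.
Proof. exact: ae_mu0pi. Qed.

Lemma eqU_sym f g : f =u g -> g =u f.
Proof. by apply: filterS => t + /= => /[apply]. Qed.

Lemma eqU_trans g f h : f =u g -> g =u h -> f =u h.
Proof. by apply: filterS2 => t /= /(_ Logic.I) -> /(_ Logic.I) ->. Qed.

Lemma eqUD f f' g g' : f =u f' -> g =u g' -> (f + g) =u (f' + g').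
Proof.
by apply: filterS2 => t /(_ Logic.I) h1 /(_ Logic.I) h2 _; rewrite !U0_valE h1 h2.
Qed.

Lemma eqUZ c f f' : f =u f' -> (c *: f) =u (c *: f').
Proof. by apply: filterS => t /(_ Logic.I) h1 _; rewrite !U0_valE h1. Qed.

Lemma eq_ipUl f f' g : f =u f' -> ipU f g = ipU f' g.
Proof.
move=> ff'; rewrite /ipU /Rintegral; congr fine; apply: ae_eq_integral => //.
- by apply/measurable_EFinP; apply: measurable_funM; exact: measurable_U0.
- by apply/measurable_EFinP; apply: measurable_funM; exact: measurable_U0.
- by apply: filterS ff' => t /= /(_ Logic.I) -> _.
Qed.

Lemma ipUZr c f g : ipU f (c *: g) = c * ipU f g.
Proof. by rewrite ipUC ipUZl ipUC. Qed.

Lemma ipUDr f g h : ipU f (g + h) = ipU f g + ipU f h.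
Proof. by rewrite ipUC ipUDl !(ipUC _ f). Qed.

Lemma ipUNl f g : ipU (- f) g = - ipU f g.
Proof. by rewrite -scaleN1r ipUZl mulN1r. Qed.

Lemma ipUNr f g : ipU f (- g) = - ipU f g.
Proof. by rewrite ipUC ipUNl ipUC. Qed.

Lemma ipU0l g : ipU 0 g = 0.
Proof. by rewrite -(scale0r 0) ipUZl mul0r. Qed.

Lemma ipU_suml (I : Type) (s : seq I) (F : I -> U0 R) g :
  ipU (\sum_(i <- s) F i) g = \sum_(i <- s) ipU (F i) g.
Proof. by elim: s => [|i s IH]; rewrite ?big_nil ?ipU0l// !big_cons ipUDl IH. Qed.

Lemma integrable_sqr_U0 f : mu.-integrable setT (fun t => (f t ^+ 2)%:E).
Proof. exact: Lfun2_integrable_sqr (LfunP f). Qed.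

Lemma EFin_ipU_sqr f : (ipU f f)%:E = (\int[mu]_t (f t ^+ 2)%:E)%E.
Proof.
rewrite /ipU /Rintegral fineK//.
by apply: integrable_fin_num => //; exact: integrable_sqr_U0.
Qed.

Lemma ipU_eq0 f : ipU f f = 0 -> f =u 0.
Proof.
move=> f0; have /(ae_eq_integral_abs mu measurableT) : measurable_fun setT
    (fun t => (f t ^+ 2)%:E).
  by apply/measurable_EFinP; apply: measurable_funX; exact: measurable_U0.
move=> [+ _]; under eq_integral do rewrite gee0_abs ?lee_fin ?sqr_ge0//.
rewrite -EFin_ipU_sqr f0 => /(_ erefl).
apply: filterS => t /= /(_ Logic.I) [/eqP].
by rewrite sqrf_eq0 => /eqP -> _.
Qed.

Lemma integral_mu0pi (f : R -> \bar R) : measurable_fun setT f ->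
  (\int[mu]_t f t = \int[lebesgue_measure]_(t in `[0%R, pi]) f t)%E.
Proof.
move=> mf; transitivity (\int[mu]_(t in `]0%R, pi[) f t)%E.
  rewrite [RHS]integral_mkcond; apply: ae_eq_integral => //.
    by apply/(measurable_restrictT _ _).1 => //; exact: measurable_funS mf.
  by apply: ae_mu0pi => t t0 _; rewrite patchE mem_set//= in_itv.
rewrite (@eq_measure_integral _ _ _ _ lebesgue_measure)/=; last first.
  by move=> A mA; rewrite /mu /mu0pi/= /mrestr => /setIidl ->.
rewrite integral_itv_bndo_bndc; last exact: measurable_funS mf.
by rewrite integral_itv_obnd_cbnd//; exact: measurable_funS mf.
Qed.

Lemma sin_natpi m : sin (m%:R * pi) = 0 :> R.
Proof.
elim: m => [|m IH]; first by rewrite mul0r sin0.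
by rewrite -[m.+1]addn1 natrD mulrDl mul1r sinDpi IH oppr0.
Qed.

Lemma integral_cos m : (0 < m)%N -> (\int[mu]_t (cos (m%:R * t))%:E = 0)%E.
Proof.
move=> m0; have mR : m%:R != 0 :> R by rewrite pnatr_eq0 -lt0n.
have cc : continuous (fun t : R => cos (m%:R * t)).
  move=> t; apply: (@cvg_comp _ _ _ (fun u : R => m%:R * u) cos).
    by apply: cvgM; [exact: cvg_cst | exact: cvg_id].
  exact: continuous_cos.
rewrite integral_mu0pi; last first.
  by apply/measurable_EFinP; exact: continuous_measurable_fun.
have dF (t : R) : is_derive t 1 (fun s => sin (m%:R * s) / m%:R) (cos (m%:R * t)).
  have d1 : is_derive t (1 : R) (fun s : R => m%:R * s) m%:R.
    by apply: is_derive_eq; rewrite /GRing.scale/= mulr1.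
  have d2 := is_derive1_comp (is_derive_sin (m%:R * t)) d1.
  have d3 := is_deriveM d2 (is_derive_cst (m%:R^-1 : R) t (1 : R)).
  rewrite (_ : (fun s => _) = (sin \o (fun s : R => m%:R * s)) * cst m%:R^-1)//.
  apply: is_derive_eq.
  by rewrite /GRing.scale/= mulr0 add0r mulrCA mulVf// mulr1.
rewrite (@continuous_FTC2 _ _ (fun t => sin (m%:R * t) / m%:R)); last 4 first.
- exact: pi_gt0.
- exact: continuous_subspaceT.
- have cF : continuous (fun s : R => sin (m%:R * s) / m%:R).
    by move=> t; apply: differentiable_continuous; apply/derivable1_diffP; case: (dF t).
  split=> [t _||]; first by case: (dF t).
  - by apply: cvg_at_right_filter; exact: cF.
  - by apply: cvg_at_left_filter; exact: cF.
- by move=> t _; rewrite derive1E; case: (dF t).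
by rewrite sin_natpi mulr0 sin0 mul0r subee.
Qed.

Lemma e_0 : e 0%N = 0.
Proof. by apply/LfuneqP => t; rewrite /e_ /= /sine mul0r sin0 mulr0. Qed.

Lemma ipU_e j k : (0 < j)%N -> (0 < k)%N -> ipU (e j) (e k) = (j == k)%:R.
Proof.
move=> j0 k0; wlog jk : j k j0 k0 / (j <= k)%N.
  move=> h; have [/h|/ltnW/h] := leqP j k; first exact.
  by rewrite ipUC eq_sym; exact.
have pi0 : pi != 0 :> R by rewrite gt_eqF// pi_gt0.
have i_cos m : mu.-integrable setT (fun t => (cos (m%:R * t))%:E).
  have mc : measurable_fun setT (fun t : R => cos (m%:R * t)).
    apply: continuous_measurable_fun => t.
    apply: (@cvg_comp _ _ _ (fun u : R => m%:R * u) cos).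
      by apply: cvgM; [exact: cvg_cst | exact: cvg_id].
    exact: continuous_cos.
  apply: (@le_integrable _ _ _ _ _ measurableT _ (fun=> 1%:E)).
  - exact/measurable_EFinP.
  - by move=> t _; rewrite /= lee_fin normr1 ler_norml cos_geN1 cos_le1.
  - exact: integrable_cst_mu0pi.
have -> : ipU (e j) (e k) = pi^-1 *
    \int[mu]_t (cos ((k - j)%:R * t) - cos ((k + j)%:R * t)).
  rewrite -RintegralZl//; last first.
    exact: (integrableB measurableT (i_cos (k - j)%N) (i_cos (k + j)%N)).
  apply: eq_Rintegral => t _; rewrite /= /sine.
  rewrite mulrACA -expr2 sqr_sqrtr ?divr_ge0 ?pi_ge0// natrB// (natrD _ k j) mulrBl.
  by rewrite cosB (mulrDl k%:R) cosD; set p := pi^-1; ring.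
have R_cos m : (0 < m)%N -> \int[mu]_t cos (m%:R * t) = 0.
  by move=> m0; rewrite /Rintegral integral_cos.
rewrite RintegralB//; [|exact: i_cos..].
rewrite (R_cos (k + j)%N) ?addn_gt0 ?k0// subr0.
have [jk_eq|jk_neq] := eqVneq j k; last first.
  by rewrite (R_cos (k - j)%N) ?mulr0// subn_gt0 ltn_neqAle jk_neq.
rewrite jk_eq subnn; under eq_Rintegral do rewrite mul0r cos0.
rewrite Rintegral_cst//= mul1r /mu0pi/= /mrestr setTI lebesgue_measure_itv/=.
by rewrite lte_fin pi_gt0 -EFinD/= subr0 mulVf.
Qed.

Definition sine_proj M f : U0 R := \sum_(1 <= k < M.+1) ipU f (e k) *: e k.

Lemma ipU_proj M f g :
  ipU (sine_proj M f) g = \sum_(1 <= k < M.+1) ipU f (e k) * ipU g (e k).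
Proof. by rewrite ipU_suml; apply: eq_bigr => k _; rewrite ipUZl (ipUC g). Qed.

Lemma ipU_proj_e M f k : (0 < k)%N ->
  ipU (sine_proj M f) (e k) = if (k <= M)%N then ipU f (e k) else 0.
Proof.
move=> k0; rewrite ipU_proj big_nat.
rewrite (eq_bigr (fun j => if j == k then ipU f (e k) else 0)); last first.
  move=> j /andP[j0 _]; rewrite ipU_e// eq_sym.
  by case: eqP => [->|_]; rewrite ?mulr1 ?mulr0.
rewrite -big_nat -big_mkcond/= big_nat1_eq.
by rewrite k0 ltnS.
Qed.

Lemma ipU_sub_proj M f k : (k <= M)%N -> ipU (f - sine_proj M f) (e k) = 0.
Proof.
move=> kM; have [->|k0] := posnP k; first by rewrite e_0 ipUC ipU0l.
by rewrite ipUDl ipUNl ipU_proj_e// kM subrr.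
Qed.

Lemma bessel_eq M f :
  ipU f f = ipU (f - sine_proj M f) (f - sine_proj M f) +
    \sum_(1 <= k < M.+1) ipU f (e k) ^+ 2.
Proof.
have h : ipU (f - sine_proj M f) (sine_proj M f) = 0.
  rewrite ipUC ipU_proj big_nat big1// => k /andP[_ kM].
  by rewrite ipU_sub_proj ?mulr0.
have -> : \sum_(1 <= k < M.+1) ipU f (e k) ^+ 2 = ipU (sine_proj M f) f.
  by rewrite ipU_proj; apply: eq_bigr => k _; rewrite expr2.
rewrite ipUDr ipUNr h subr0 ipUDl ipUNl; ring.
Qed.

Lemma sine_proj_cvg f eps : 0 < eps -> exists N, forall M, (N <= M)%N ->
  ipU (f - sine_proj M f) (f - sine_proj M f) < eps.
Proof.
move=> eps0; have [_ /(_ _ eps0) [g [n [c gE]] fg]] :=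
  L2_sine_approx (measurable_U0 f) (integrable_sqr_U0 f).
have s0 : Num.sqrt (2 / pi) != 0 :> R.
  by rewrite gt_eqF// sqrtr_gt0 divr_gt0// pi_gt0.
pose G : U0 R := \sum_(0 <= k < n) (c k / Num.sqrt (2 / pi)) *: e k.
have GE t : G t = g t.
  rewrite U0_val_sum gE big_mkord; apply: eq_bigr => k _.
  by rewrite U0_valZ /= /sine mulrA mulfVK.
have fG : ipU (f - G) (f - G) < eps.
  rewrite -lte_fin EFin_ipU_sqr; apply: le_lt_trans fg.
  rewrite le_eqVlt; apply/orP; left; apply/eqP; apply: eq_integral => t _.
  by rewrite !U0_valE GE.
exists n => M nM; apply: le_lt_trans fG.
have h g' : (forall k, (k <= M)%N -> ipU g' (e k) = 0) -> ipU g' (sine_proj M f - G) = 0.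
  move=> h; rewrite ipUC ipUDl ipUNl ipU_proj /G ipU_suml !big_nat !big1 ?subr0//.
  - move=> k /andP[_ kn]; rewrite ipUZl ipUC h ?mulr0//.
    by rewrite ltnW// (leq_trans kn).
  - by move=> k /andP[_ kM]; rewrite h ?mulr0.
have -> : f - G = (f - sine_proj M f) + (sine_proj M f - G) by rewrite addrA subrK.
have := h (f - sine_proj M f) (fun k => @ipU_sub_proj M f k).
move: (f - sine_proj M f) (sine_proj M f - G) => D d Dd.
by rewrite ipUDl !ipUDr (ipUC d D) Dd addr0 add0r lerDl ipU_ge0.
Qed.

Lemma sine_total f : (forall k, (0 < k)%N -> ipU f (e k) = 0) -> f =u 0.
Proof.
move=> f0; apply: ipU_eq0; apply/eqP; rewrite eq_le ipU_ge0 andbT.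
apply/ler_addgt0Pl => eps eps0; rewrite addr0.
have [N /(_ N (leqnn N))] := sine_proj_cvg f eps0.
rewrite /sine_proj big_nat big1 ?subr0; first exact: ltW.
by move=> k /andP[k0 _]; rewrite f0// scale0r.
Qed.

End SineBasisU0.

Section HilbertH0.
Variable R : realType.
Implicit Types (x y z v w : H0 R) (A : H0 R -> H0 R) (M k : nat) (s c : R).
Local Notation e := (e_ R).
Local Open Scope complex_scope.

Lemma eqH_refl x : x =h x.
Proof. by split; exact: eqU_refl. Qed.

Lemma eqH_sym x y : x =h y -> y =h x.
Proof. by move=> [? ?]; split; exact: eqU_sym. Qed.

Lemma eqH_trans x y z : x =h y -> y =h z -> x =h z.
Proof.
by move=> [h1 h2] [h3 h4]; split; [exact: eqU_trans h3|exact: eqU_trans h4].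
Qed.

Lemma eqHD x x' y y' : x =h x' -> y =h y' -> (x + y) =h (x' + y').
Proof. by move=> [? ?] [? ?]; split; exact: eqUD. Qed.

Lemma eqHZ (a : R[i]) x x' : x =h x' -> (a *: x) =h (a *: x').
Proof.
move=> [h1 h2]; split => /=; apply: eqUD; rewrite -?scaleNr; exact: eqUZ.
Qed.

Lemma eq_ipHl x x' y : x =h x' -> ipH x y = ipH x' y.
Proof. by move=> [h1 h2]; rewrite /ipH !(eq_ipUl _ h1) !(eq_ipUl _ h2). Qed.

Lemma eq_ipHr x y y' : y =h y' -> ipH x y = ipH x y'.
Proof.
move=> [h1 h2]; rewrite /ipH !(ipUC x.1) !(ipUC x.2).
by rewrite !(eq_ipUl _ h1) !(eq_ipUl _ h2).
Qed.

Lemma normH_sqr x : normH x ^+ 2 = ipU x.1 x.1 + ipU x.2 x.2.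
Proof. by rewrite /normH sqr_sqrtr//= addr_ge0 ?ipU_ge0. Qed.

Lemma normH_ge0 x : 0 <= normH x. Proof. exact: sqrtr_ge0. Qed.

Lemma eq_normH x y : x =h y -> normH x = normH y.
Proof.
by move=> xy; rewrite /normH (eq_ipHl _ xy) (eq_ipHr _ xy).
Qed.

Lemma normH_eq0 x : normH x = 0 -> x =h 0.
Proof.
move=> x0; have : normH x ^+ 2 = 0 by rewrite x0 expr0n.
rewrite normH_sqr => /eqP; rewrite paddr_eq0 ?ipU_ge0// => /andP[/eqP h1 /eqP h2].
by split; exact: ipU_eq0.
Qed.

Lemma ipHDl x y z : ipH (x + y) z = ipH x z + ipH y z.
Proof.
rewrite /ipH/= !ipUDl; apply/eqP; rewrite eq_complex/=.
by apply/andP; split; apply/eqP; ring.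
Qed.

Lemma ipHZl c x y : ipH (c%:C *: x) y = c%:C * ipH x y.
Proof.
rewrite /ipH scale_realE/= !ipUZl; apply/eqP; rewrite eq_complex/=.
by apply/andP; split; apply/eqP; ring.
Qed.

Lemma ipHZr c x y : ipH x (c%:C *: y) = c%:C * ipH x y.
Proof.
rewrite /ipH scale_realE/= !ipUZr; apply/eqP; rewrite eq_complex/=.
by apply/andP; split; apply/eqP; ring.
Qed.

Lemma ipH_toH x (f : U0 R) : ipH x (toH f) = ipU x.1 f +i* ipU x.2 f.
Proof. by rewrite /ipH/= !(ipUC _ 0) !ipU0l addr0 subr0. Qed.

Lemma ipHxx x : ipH x x = (normH x ^+ 2)%:C.
Proof. by rewrite normH_sqr /ipH (ipUC x.2) subrr. Qed.

Lemma cscale_toH (a : R[i]) (f : U0 R) :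
  a *: toH f = (complex.Re a *: f, complex.Im a *: f) :> H0 R.
Proof.
by congr pair; rewrite /= !scaler0 ?subr0 ?add0r.
Qed.

Lemma PME M x : PM M x = (sine_proj M x.1, sine_proj M x.2).
Proof.
rewrite /PM /sine_proj; elim/big_rec3 : _ => // k f g y _ ->.
by rewrite ipH_toH cscale_toH.
Qed.

Definition coef_sqr x k : R := ipU x.1 (e k) ^+ 2 + ipU x.2 (e k) ^+ 2.

Lemma normH_sqr_PM M x : normH x ^+ 2 =
  normH (x - PM M x) ^+ 2 + \sum_(1 <= k < M.+1) coef_sqr x k.
Proof.
have -> : normH (x - PM M x) ^+ 2 =
    ipU (x.1 - sine_proj M x.1) (x.1 - sine_proj M x.1) +
    ipU (x.2 - sine_proj M x.2) (x.2 - sine_proj M x.2) by rewrite normH_sqr PME.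
rewrite normH_sqr big_split/= addrACA.
exact: (congr2 +%R (bessel_eq M x.1) (bessel_eq M x.2)).
Qed.

Lemma ipU_sine_proj_self M (f : U0 R) :
  ipU (sine_proj M f) (sine_proj M f) = \sum_(1 <= k < M.+1) ipU f (e k) ^+ 2.
Proof.
rewrite ipU_proj !big_nat; apply: eq_bigr => k /andP[k0 kM].
by rewrite ipU_proj_e// -ltnS kM expr2.
Qed.

Lemma normH_PM M x : normH (PM M x) ^+ 2 = \sum_(1 <= k < M.+1) coef_sqr x k.
Proof. by rewrite normH_sqr PME/= !ipU_sine_proj_self -big_split. Qed.

Lemma PM_idem M x : PM M (PM M x) = PM M x.
Proof.
have idem (f : U0 R) : sine_proj M (sine_proj M f) = sine_proj M f.
  rewrite [LHS]big_nat [RHS]big_nat; apply: eq_bigr => k /andP[k0 kM].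
  by rewrite ipU_proj_e// -ltnS kM.
by rewrite !PME/= !idem.
Qed.

Lemma PM_cvg x eps : 0 < eps -> exists N, forall M, (N <= M)%N ->
  normH (x - PM M x) ^+ 2 < eps.
Proof.
move=> eps0; have e2 : 0 < eps / 2 by rewrite divr_gt0.
have [N1 h1] := sine_proj_cvg x.1 e2; have [N2 h2] := sine_proj_cvg x.2 e2.
exists (maxn N1 N2) => M; rewrite geq_max => /andP[m1 m2].
rewrite normH_sqr PME/= (splitr eps) ltrD//; [exact: h1|exact: h2].
Qed.

Lemma sine_totalH x : (forall k, (0 < k)%N -> ipH x (toH (e k)) = 0) -> x =h 0.
Proof.
move=> x0; split; apply: sine_total => k /x0; rewrite ipH_toH => /eqP;
  by rewrite eq_complex/= => /andP[/eqP ? /eqP ?].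
Qed.

Lemma linearH0 A : linearH A -> A 0 =h 0.
Proof.
move=> lA; have := linearH_linear lA 1 0 0; rewrite scaler0 addr0 scale1r => h.
have := eqHD h (eqH_refl (- A 0)); rewrite addrK subrr => h'.
exact: eqH_sym.
Qed.

Lemma linearHZ A (a : R[i]) x : linearH A -> A (a *: x) =h (a *: A x).
Proof.
move=> lA; have := linearH_linear lA a x 0; rewrite addr0 => h.
apply: (eqH_trans h); rewrite -[X in _ =h X]addr0.
by apply: eqHD; [exact: eqH_refl|exact: linearH0].
Qed.

Lemma linearHD A x y : linearH A -> A (x + y) =h (A x + A y).
Proof. by move=> lA; have := linearH_linear lA 1 x y; rewrite !scale1r. Qed.

Lemma linearHB A x y : linearH A -> A (x - y) =h (A x - A y).
Proof.
move=> lA; apply: (eqH_trans (linearHD _ _ lA)); apply: eqHD; first exact: eqH_refl.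
by rewrite -scaleN1r -[X in _ =h X]scaleN1r; exact: linearHZ.
Qed.

Lemma linearH_sum A (s : seq nat) (a : nat -> R[i]) (v : nat -> H0 R) : linearH A ->
  A (\sum_(i <- s) a i *: v i) =h (\sum_(i <- s) a i *: A (v i)).
Proof.
move=> lA; elim: s => [|i s IH]; first by rewrite !big_nil; exact: linearH0.
rewrite !big_cons; apply: (eqH_trans (linearH_linear lA _ _ _)).
by apply: eqHD => //; exact: eqH_refl.
Qed.

Lemma eqH_sum_nat m n (F G : nat -> H0 R) :
  (forall i, (m <= i < n)%N -> F i =h G i) ->
  (\sum_(m <= i < n) F i) =h (\sum_(m <= i < n) G i).
Proof.
move=> FG; rewrite !big_nat; elim/big_ind2 : _ => //; first exact: eqH_refl.
by move=> *; exact: eqHD.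
Qed.

(* With [w := A v - s v], [A w = - s w], and nonnegativity of [A] forces [w = 0]
   when [s > 0]. *)
Lemma nonneg_sqrt_eigen A c v : nonneg_symmetricH A -> 0 <= c ->
  A (A v) =h (c%:C *: v) -> A v =h ((Num.sqrt c)%:C *: v).
Proof.
move=> [lA sA pA] c0 AAv; set s := Num.sqrt c.
have s0 : 0 <= s by exact: sqrtr_ge0.
have cE : c = s ^+ 2 by rewrite sqr_sqrtr.
have [s_eq0|s_neq0] := eqVneq s 0.
  rewrite s_eq0 scale0r; apply: normH_eq0; apply/eqP; rewrite -sqrf_eq0; apply/eqP.
  have /eqP := ipHxx (A v); rewrite sA (eq_ipHr _ AAv) ipHZr cE s_eq0 expr0n/= mul0r.
  by rewrite eq_sym eq_complex/= => /andP[/eqP].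
pose w := A v - s%:C *: v.
have Aw : A w =h ((- s)%:C *: w).
  apply: (eqH_trans (linearHB _ _ lA)).
  have -> : (- s)%:C *: w = c%:C *: v - s%:C *: A v.
    by rewrite cE expr2 !rmorphM rmorphN /w scalerBr !scaleNr opprK scalerA addrC.
  apply: eqHD => //; rewrite -scaleN1r -[X in _ =h X]scaleN1r.
  by apply: eqHZ; exact: linearHZ.
have w0 : normH w = 0.
  have := pA w; rewrite (eq_ipHl _ Aw) ipHZl ipHxx -rmorphM lecR mulNr oppr_ge0 => h.
  apply/eqP; rewrite -sqrf_eq0 eq_le sqr_ge0 andbT.
  by rewrite -(pmulr_rle0 _ (_ : 0 < s))// lt_def s_neq0.
have := eqHD (normH_eq0 w0) (eqH_refl (s%:C *: v)).
by rewrite /w subrK add0r.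
Qed.

Lemma ipH_eigen A s v y : nonneg_symmetricH A -> A v =h (s%:C *: v) ->
  ipH (A y) v = s%:C * ipH y v.
Proof. by move=> [_ sA _] Av; rewrite sA (eq_ipHr _ Av) ipHZr. Qed.

Lemma eqU0P (S : U0 R -> U0 R) : linearU S -> S 0 =u 0.
Proof.
move=> lS; have := linearU_linear lS 1 0 0; rewrite scaler0 addr0 scale1r => h.
have := eqUD h (eqU_refl (- S 0)); rewrite addrK subrr => h'.
exact: eqU_sym.
Qed.

Lemma linearU_extH (S : U0 R -> U0 R) : linearU S -> linearH (extH S).
Proof.
move=> lS; have lin a b f g h : S (a *: f + b *: g + h) =u (a *: S f + b *: S g + S h).
  rewrite -!addrA; apply: (eqU_trans (linearU_linear lS _ _ _)).
  by apply: eqUD; [exact: eqU_refl|exact: linearU_linear].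
split=> [x y [h1 h2]|a x y]; first by split; exact: linearU_ae.
by split => /=; rewrite -?scaleNr; exact: lin.
Qed.

Lemma nonneg_symmetric_extH (S : U0 R -> U0 R) :
  nonneg_symmetricU S -> nonneg_symmetricH (extH S).
Proof.
move=> [lS sS pS]; split; first exact: linearU_extH.
- by move=> x y; rewrite /ipH/= !sS.
- move=> x; rewrite lecE/= addr_ge0// andbT.
  by rewrite sS (ipUC x.2) subrr.
Qed.

(* [A] determines the coefficients along the [e_k] with nonzero eigenvalue. *)
Lemma eigen_PM_min A (s : nat -> R) M w y : nonneg_symmetricH A ->
  (forall k, (0 < k <= M)%N -> A (toH (e k)) =h ((s k)%:C *: toH (e k))) ->
  (forall k, (0 < k <= M)%N -> s k = 0 -> ipH w (toH (e k)) = 0) ->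
  A y =h A w -> normH (PM M w) <= normH y.
Proof.
move=> nA eA w0 Ayw; rewrite -(@ler_pXn2r _ 2)// ?nnegrE ?normH_ge0//.
rewrite (normH_sqr_PM M y) -[leLHS]add0r lerD ?sqr_ge0// normH_PM.
rewrite !big_nat; apply: ler_sum => k kM.
suff : ipH w (toH (e k)) = ipH y (toH (e k)) \/ ipH w (toH (e k)) = 0.
  rewrite !ipH_toH => -[/eqP|/eqP]; rewrite eq_complex/= => /andP[/eqP h1 /eqP h2].
    by rewrite /coef_sqr h1 h2.
  by rewrite /coef_sqr h1 h2 expr0n addr0 addr_ge0 ?sqr_ge0.
have [/(w0 _ kM)|sk] := eqVneq (s k) 0; first by right.
left; have := eq_ipHl (toH (e k)) Ayw.
rewrite !(ipH_eigen _ nA (eA k kM)) => /mulfI -> //.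
by rewrite eq_complex/= negb_and sk.
Qed.

Lemma gaussian_rateE (alpha : R) A (D : set (H0 R)) x w :
  D w -> A w =h x -> (forall y, D y -> A y =h x -> normH w <= normH y) ->
  gaussian_rate alpha A D x = ((alpha ^+ 2)^-1 * normH w ^+ 2)%:E.
Proof.
move=> Dw Aw mw; rewrite /gaussian_rate asboolT; last by exists w.
have [Dz Az mz] : min_norm_preimage A D x (pseudo_inverse A D x).
  by apply: (xgetPex 0); exists w.
congr (_ * _ ^+ 2)%:E; apply/eqP; rewrite eq_le.
by rewrite mz// mw.
Qed.

End HilbertH0.

(** * Uniqueness of rate functions *)

Section RateFunctionUniqueness.
Variables (R : realType) (d : measure_display) (Omega : measurableType d).
Variable P : probability Omega R.
Implicit Types (x y z : H0 R) (G C : set (H0 R)).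

Lemma nbhs_H0P x (A : set (H0 R)) :
  nbhs x A <-> exists2 e : R, 0 < e & ballH x e `<=` A.
Proof.
split=> [/nbhs_ballP[e /= e0 h]|[e e0 h]]; first by exists e.
by apply/nbhs_ballP; exists e.
Qed.

Lemma normH_realZ (c : R) x : normH (c%:C%C *: x) = `|c| * normH x.
Proof.
rewrite /normH -sqrtr_sqr -sqrtrM ?sqr_ge0//; congr Num.sqrt.
by rewrite scale_realE/= !ipUZl !(ipUC _ (c *: _)) !ipUZl; ring.
Qed.

Lemma continuous_realZ (c : R) : continuous (fun x : H0 R => c%:C%C *: x).
Proof.
move=> x A /nbhs_H0P[e e0 h]; apply/nbhs_H0P.
have c0 : 0 < `|c| + 1 by rewrite ltr_wpDl.
exists (e / (`|c| + 1)); first exact: divr_gt0.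
move=> y xy; apply: h; rewrite /ballH -scalerBr normH_realZ.
have := xy; rewrite /ballH ltr_pdivlMr//; apply: le_lt_trans.
by rewrite mulrC ler_wpM2l ?sqrtr_ge0// lerDl.
Qed.

Lemma random_variable_scaled (u : R -> Omega -> H0 R) (T : R) :
  Defs.random_variable (u T) -> Defs.random_variable (scaled_process u T).
Proof.
move=> hu G oG; apply: (hu (fun x => G (T^-1%:C%C *: x))).
by move/continuousP : (@continuous_realZ T^-1); exact.
Qed.

Lemma le_lne (a b : \bar R) : (0 <= a)%E -> (a <= b)%E -> (lne a <= lne b)%E.
Proof.
move=> a0 ab; rewrite lee_lne// in_itv/= leey andbT//.
exact: le_trans ab.
Qed.

Lemma limf_einf_le_esup (F : set_system R) (f g : R -> \bar R) : ProperFilter F ->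
  (\forall t \near F, f t <= g t)%E -> (limf_einf f F <= limf_esup g F)%E.
Proof.
move=> PF fg; rewrite limf_einfE limf_esupE.
apply: ge_ereal_sup => _ [V FV <-]; apply: le_ereal_inf_tmp => _ [V' FV' <-].
have [t [[Vt V't] fgt]] := filter_ex (filterI (filterI FV FV') fg).
apply: (@le_trans _ _ (f t)); first by apply: ereal_inf_lbound; exists t.
by apply: (le_trans fgt); apply: ereal_sup_ubound; exists t.
Qed.

Lemma open_ballH x (r : R) : open [set y | normH (x - y) < r].
Proof.
rewrite openE => y /= xy; apply/nbhs_H0P; exists (r - normH (x - y)).
  by rewrite subr_gt0.
move=> z; rewrite /ballH ltrBrDl => yz /=; apply: le_lt_trans yz.
by rewrite -(subrKA y x (- z)) ler_normHD.
Qed.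

Lemma closed_ballH x (r : R) : closed [set y | normH (x - y) <= r].
Proof.
rewrite -openC openE => y /= /negP; rewrite -ltNge => xy.
apply/nbhs_H0P; exists (normH (x - y) - r); first by rewrite subr_gt0.
move=> z; rewrite /ballH ltrBrDl -normHN opprB => yz /=; apply/negP; rewrite -ltNge.
rewrite -(ltrD2r (normH (z - y))); apply: (lt_le_trans yz).
by rewrite -(subrKA z x (- y)) ler_normHD.
Qed.

Lemma LDP_rate_le (Z : R -> Omega -> H0 R) (I J : H0 R -> \bar R) :
  (forall T, 0 < T -> Defs.random_variable (Z T)) ->
  LDP P Z I -> LDP P Z J -> forall x, (J x <= I x)%E.
Proof.
move=> rvZ hI hJ x; rewrite leNgt; apply/negP => IJ.
have [c Ic cJ] : exists2 c : R, (I x < c%:E)%E & (c%:E < J x)%E.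
  move: (ldp_ge0 hI x) IJ; case: (I x) (J x) => [a||] [b||]//=.
  - by rewrite !lte_fin => _ ab; exists ((a + b) / 2); rewrite lte_fin; lra.
  - by move=> _ _; exists (a + 1); rewrite ?ltry// lte_fin ltrDl.
have [V /nbhs_H0P[e e0 eV] hV] := ldp_lsc hJ cJ.
have r0 : 0 < e / 2 by rewrite divr_gt0.
have oG := @open_ballH x (e / 2); have cC := @closed_ballH x (e / 2).
have /= hG := ldp_open hI oG; have /= hC := ldp_closed hJ cC.
set G := [set y | _] in oG hG; set C := [set y | _] in cC hC.
have GI : (- I x <= - ereal_inf (I @` G))%E.
  rewrite leeN2; apply: ereal_inf_lbound; exists x => //.
  by rewrite /G/= subrr normH0.
have CJ : (- ereal_inf (J @` C) <= - c%:E)%E.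
  rewrite leeN2; apply: le_ereal_inf_tmp => _ [y Cy <-]; apply/ltW/hV/eV.
  by apply: (le_lt_trans Cy); rewrite ltr_pdivrMr// ltr_pMr// ltr1n.
have : (- I x <= - c%:E)%E.
  apply: (le_trans GI); apply: (le_trans hG); apply: le_trans CJ.
  apply: le_trans hC; apply: limf_einf_le_esup.
  near=> T; have T0 : 0 < T by near: T; exact: nbhs_pinfty_gt.
  rewrite lee_pmul2l ?lte_fin ?invr_gt0//; apply: le_lne => //.
  apply: le_measure; rewrite ?inE.
  - exact: rvZ.
  - rewrite -[X in measurable X]setCK; apply: measurableC.
    by have := rvZ T T0 (~` C) (closed_openC cC).
  - by move=> w /= /ltW.
by rewrite leeN2 leNgt Ic.
Unshelve. all: by end_near. Qed.

Lemma LDP_rate_unique (Z : R -> Omega -> H0 R) (I J : H0 R -> \bar R) :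
  (forall T, 0 < T -> Defs.random_variable (Z T)) ->
  LDP P Z I -> LDP P Z J -> I =1 J.
Proof.
by move=> rvZ hI hJ x; apply/eqP; rewrite eq_le !(LDP_rate_le rvZ).
Qed.

End RateFunctionUniqueness.

(** * Convergence of the rates *)

Section RateApproximation.
Variables (R : realType) (eta : nat -> R).
Hypothesis eta_ge0 : forall k, (0 < k)%N -> 0 <= eta k.
Hypothesis eta_noninc : forall k l, (0 < k)%N -> (k <= l)%N -> eta l <= eta k.
Variables (Q S : U0 R -> U0 R).
Hypothesis hQ : linearU Q.
Hypothesis hQe : forall k, (0 < k)%N -> Q (e_ R k) =u (eta k *: e_ R k).
Hypothesis hS : sqrt_opU Q S.
Local Notation e := (e_ R).
Local Open Scope complex_scope.

Lemma extH_Q_e k : (0 < k)%N ->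
  extH Q (toH (e k)) =h ((eta k)%:C *: (toH (e k) : H0 R)).
Proof.
move=> k0; rewrite scale_realE; split => /=; first exact: hQe.
by rewrite scaler0; exact: eqU0P.
Qed.

Lemma extH_S_e k : (0 < k)%N ->
  extH S (toH (e k)) =h ((Num.sqrt (eta k))%:C *: (toH (e k) : H0 R)).
Proof.
move=> k0; have [nS SS] := hS.
apply: nonneg_sqrt_eigen; [exact: nonneg_symmetric_extH|exact: eta_ge0|].
by apply: eqH_trans (extH_Q_e k0); split; exact: SS.
Qed.

Lemma sqrt_QM_e M (T : H0 R -> H0 R) k : sqrt_opH (fun x => extH Q (PM M x)) T ->
  (0 < k <= M)%N -> T (toH (e k)) =h ((Num.sqrt (eta k))%:C *: (toH (e k) : H0 R)).
Proof.
move=> [nT TT] /andP[k0 kM].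
apply: nonneg_sqrt_eigen => //; first exact: eta_ge0.
apply: eqH_trans (TT _) _; apply: eqH_trans (extH_Q_e k0).
rewrite (_ : PM M (toH (e k)) = toH (e k)); first exact: eqH_refl.
rewrite PME /sine_proj /=; congr pair; last first.
  by rewrite big1// => j _; rewrite ipU0l scale0r.
rewrite big_nat (eq_bigr (fun j => if j == k then e k else 0)).
  by rewrite -big_nat -big_mkcond/= big_nat1_eq k0 ltnS kM.
move=> j /andP[j0 _]; rewrite ipU_e// eq_sym.
by case: eqP => [->|_]; rewrite ?scale1r ?scale0r.
Qed.

(* As [eta] is nonincreasing, either all [eta k] are positive, or [S] kills all
   [e_ k] from some rank [n] on and [PM n.-1 z] will do. *)
Lemma preimage_without_kernel z : exists2 z',
  extH S z' =h extH S z &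
  forall k, (0 < k)%N -> eta k = 0 -> ipH z' (toH (e k)) = 0.
Proof.
have [[k0 /andP[k0_gt0 /eqP etak0]]|npos] :=
    pselect (exists k, (0 < k)%N && (eta k == 0)); last first.
  exists z; first exact: eqH_refl.
  by move=> k k0 etak; exfalso; apply: npos; exists k; rewrite k0 etak eqxx.
have ex : exists k, (0 < k)%N && (eta k == 0) by exists k0; rewrite k0_gt0 etak0 eqxx.
have [n /andP[n0 /eqP etan] nmin] := ex_minnP ex.
have coefPM k : (0 < k)%N -> ipH (PM n.-1 z) (toH (e k)) =
    if (k < n)%N then ipH z (toH (e k)) else 0.
  move=> k1; rewrite PME !ipH_toH/= !ipU_proj_e// -ltnS prednK//.
  by case: ifP.
exists (PM n.-1 z); last first.
  move=> k k1 etak; rewrite coefPM// ltnNge nmin// k1 etak; exact/eqP.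
have [nS _] := hS; have nA := nonneg_symmetric_extH nS.
have d0 : (extH S (PM n.-1 z - z)) =h 0.
  apply: sine_totalH => k k1; rewrite (ipH_eigen _ nA (extH_S_e k1)).
  rewrite ipHDl -scaleN1r (_ : -1 = (-1)%:C); last by rewrite rmorphN1.
  rewrite ipHZl coefPM//; case: ifPn => [_|]; first by rewrite rmorphN1 mulN1r subrr mulr0.
  rewrite -leqNgt => nk; have -> : eta k = 0.
    by apply/eqP; rewrite eq_le eta_ge0// -etan eta_noninc.
  by rewrite sqrtr0 mul0r.
have := eqHD (eqH_trans (eqH_sym (linearHB _ _ (nsH_linear nA))) d0) (eqH_refl (extH S z)).
by rewrite subrK add0r.
Qed.

Lemma rate_approximation (alpha B : R) (QMhalf : nat -> H0 R -> H0 R) x :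
  0 < alpha -> (forall f, normU (S f) ^+ 2 <= B * normU f ^+ 2) ->
  (forall M, (0 < M)%N -> sqrt_opH (fun x => extH Q (PM M x)) (QMhalf M)) ->
  (exists z, extH S z =h x) ->
  forall eps : R, 0 < eps -> exists (x0 : H0 R) (M : nat), [/\ (0 < M)%N,
    normH (x - x0) < eps &
    (`|gaussian_rate alpha (extH S) setT x -
       gaussian_rate alpha (QMhalf M) (HM M) x0| < eps%:E)%E].
Proof.
move=> alpha0 bS hT [z0 Sz0] eps eps0.
have [z Szz0 z_ker] := preimage_without_kernel z0.
have Sz : extH S z =h x by exact: eqH_trans Sz0.
have [nS _] := hS; have nA := nonneg_symmetric_extH nS.
have bA y : normH (extH S y) ^+ 2 <= `|B| * normH y ^+ 2.
  have nU f : normU f ^+ 2 = ipU f f by rewrite /normU sqr_sqrtr// ipU_ge0.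
  rewrite !normH_sqr/= mulrDr; apply: lerD.
  - rewrite -!nU; apply: le_trans (bS _) _.
    by rewrite ler_wpM2r ?sqr_ge0// ler_norm.
  - rewrite -!nU; apply: le_trans (bS _) _.
    by rewrite ler_wpM2r ?sqr_ge0// ler_norm.
have sqrt_ker k : (0 < k)%N -> Num.sqrt (eta k) = 0 -> eta k = 0.
  move=> k0 /eqP; rewrite sqrtr_eq0 => etak.
  by apply/eqP; rewrite eq_le etak eta_ge0.
have a2 : 0 < alpha ^+ 2 by rewrite exprn_gt0.
have B1 : 0 < `|B| + 1 by rewrite ltr_wpDl.
pose delta := Num.min (eps * alpha ^+ 2) (eps ^+ 2 / (`|B| + 1)).
have delta0 : 0 < delta.
  by rewrite lt_min !mulr_gt0// ?invr_gt0// exprn_gt0.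
have [N hN] := PM_cvg z delta0.
pose M := maxn N 1; have M0 : (0 < M)%N by rewrite leq_max orbT.
have := hN M (leq_maxl _ _); rewrite lt_min ltr_pdivlMr// => /andP[tail1 tail2].
have [nT TT] := hT M M0.
exists (QMhalf M (PM M z)), M; split => //.
- have Tx0 : QMhalf M (PM M z) =h extH S (PM M z).
    rewrite /PM; apply: eqH_trans (linearH_sum _ _ _ (nsH_linear nT)) _.
    apply: eqH_sym; apply: eqH_trans (linearH_sum _ _ _ (nsH_linear nA)) _.
    apply: eqH_sum_nat => k /andP[k0 kM]; apply: eqHZ.
    apply: eqH_trans (extH_S_e k0) _; apply: eqH_sym.
    by apply: (sqrt_QM_e (hT M M0)); rewrite k0 -ltnS kM.
  rewrite (eq_normH (_ : _ =h extH S (z - PM M z))); last first.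
    apply: eqH_sym; apply: eqH_trans (linearHB _ _ (nsH_linear nA)) _.
    apply: eqHD => //; rewrite -scaleN1r -[X in _ =h X]scaleN1r.
    by apply: eqHZ; exact: eqH_sym.
  rewrite -(@ltr_pXn2r _ 2)// ?nnegrE ?normH_ge0 ?ltW//.
  apply: le_lt_trans (bA _) _; apply: le_lt_trans tail2.
  by rewrite mulrC ler_wpM2l ?sqr_ge0// lerDl.
- have -> : gaussian_rate alpha (extH S) setT x = ((alpha ^+ 2)^-1 * normH z ^+ 2)%:E.
    apply: gaussian_rateE => // y _ Sy.
    have Syz : extH S y =h extH S z by apply: eqH_trans Sy _; exact: eqH_sym.
    have PMy m : normH (PM m z) <= normH y.
      apply: (eigen_PM_min (s := fun k => Num.sqrt (eta k)) nA _ _ Syz).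
      - by move=> k /andP[k0 _]; exact: extH_S_e.
      - by move=> k /andP[k0 _] /(sqrt_ker _ k0); exact: z_ker.
    rewrite -(@ler_pXn2r _ 2)// ?nnegrE ?normH_ge0//.
    apply/ler_addgt0Pl => r r0; have [m /(_ m (leqnn m)) hm] := PM_cvg z r0.
    rewrite (normH_sqr_PM m z) -normH_PM; apply: lerD; first exact: ltW.
    by rewrite ler_pXn2r ?nnegrE ?normH_ge0.
  have -> : gaussian_rate alpha (QMhalf M) (HM M) (QMhalf M (PM M z)) =
      ((alpha ^+ 2)^-1 * normH (PM M z) ^+ 2)%:E.
    apply: gaussian_rateE; [|exact: eqH_refl|].
    - by exists (fun k => ipH z (toH (e k))); exact: eqH_refl.
    move=> y _ Ty.
    rewrite -PM_idem; apply: (eigen_PM_min (s := fun k => Num.sqrt (eta k)) nT _ _ Ty).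
    + by move=> k kM; exact: (sqrt_QM_e (hT M M0)).
    + move=> k /andP[k0 kM] /(sqrt_ker _ k0)/(z_ker _ k0); rewrite PME !ipH_toH/=.
      by rewrite !ipU_proj_e// kM.
  rewrite -EFinB abse_EFin lte_fin -mulrBr normrM gtr0_norm ?invr_gt0//.
  rewrite mulrC ltr_pdivrMr// (normH_sqr_PM M z) -normH_PM addrK ger0_norm//.
  exact: sqr_ge0.
Qed.

End RateApproximation.

Theorem theorem4p3 (R : realType) (d : measure_display)
    (Omega : measurableType d) (P : probability Omega R)
    (alpha : R) (alpha_gt0 : 0 < alpha)
    (* the initial value *)
    (u0 : H0 R) (hu0 : H10 u0.1 /\ H10 u0.2)
    (* the covariance operator Q and its square root on U^0 *)
    (eta : nat -> R)
    (eta_ge0 : forall k, (0 < k)%N -> 0 <= eta k)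
    (eta_noninc : forall k l, (0 < k)%N -> (k <= l)%N -> eta l <= eta k)
    (Q Qhalf : U0 R -> U0 R)
    (hQ : nonneg_symmetricU Q)
    (hQe : forall k, (0 < k)%N -> Q (e_ R k) =u eta k *: e_ R k)
    (hQhalf : sqrt_opU Q Qhalf)
    (hHS : hilbert_schmidt_U0_U1 Qhalf)
    (* the square roots of Q_M = Q P_M on H^0 *)
    (QMhalf : nat -> H0 R -> H0 R)
    (hQMhalf : forall M, (0 < M)%N ->
       sqrt_opH (fun x => extH Q (PM M x)) (QMhalf M))
    (* the noise, the mild solution and the Galerkin approximations *)
    (beta : nat -> R -> Omega -> R) (W : R -> Omega -> U0 R)
    (hW : wiener_process P eta beta W)
    (E : R -> H0 R -> H0 R) (hE : schrodinger_group E)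
    (u : R -> Omega -> H0 R) (hu : mild_solution P alpha u0 E W u)
    (uM : nat -> R -> Omega -> H0 R)
    (huM : forall M, (0 < M)%N -> galerkin_solution P alpha u0 W M (uM M))
    (* the known large deviations principles with their explicit rates *)
    (ldp_B : LDP P (scaled_process u) (gaussian_rate alpha (extH Qhalf) setT))
    (ldp_BM : forall M, (0 < M)%N ->
       LDP P (scaled_process (uM M)) (gaussian_rate alpha (QMhalf M) (HM M)))
    (* the rate functions of B_T and B^M_T *)
    (I : H0 R -> \bar R) (hI : LDP P (scaled_process u) I)
    (IM : nat -> H0 R -> \bar R)
    (hIM : forall M, (0 < M)%N -> LDP P (scaled_process (uM M)) (IM M)) :
  forall x : H0 R, (exists z : H0 R, extH Qhalf z =h x) ->
  forall eps : R, 0 < eps ->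
  exists (x0 : H0 R) (M : nat), (0 < M)%N /\
    normH (x - x0) < eps /\ (`| I x - IM M x0 | < eps%:E)%E.
Proof.
move=> x Sx eps eps0; have [D [_ [B hB] _]] := hHS.
have bS f : normU (Qhalf f) ^+ 2 <= B * normU f ^+ 2.
  by apply: le_trans (hB f); rewrite lerDl sqr_ge0.
have [x0 [M [M0 xx0 IIM]]] := rate_approximation eta_ge0 eta_noninc
  (nsU_linear hQ) hQe hQhalf alpha_gt0 bS hQMhalf Sx eps0.
have IE := LDP_rate_unique
  (fun T T0 => random_variable_scaled (hu T (ltW T0)).1) hI ldp_B.
have IME := LDP_rate_unique
  (fun T T0 => random_variable_scaled ((huM M M0).1 T (ltW T0))) (hIM M M0) (ldp_BM M M0).
by exists x0, M; rewrite IE IME.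
Qed.
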